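(* Let $(R,\mathfrak{m})$ be a commutative noetherian local ring, and let $M$ be a separated $R$-module such that its $\mathfrak{m}$-adic completion $\hat M$ is flat as an $R$-module. Let $M\subset N$ be a pure-injective hull of $M$. Then: (a) $N/M$ is radical-full, and $H(N)$ is a direct summand of $N$. (b) $\hat M\cong N/H(N)$. (c) $\operatorname{Ass}(\hat M)=\operatorname{Koatt}(M)$.
   Context: For an $R$-module $A$ put $H(A)=\bigcap_{n\ge1}\mathfrak{m}^nA$; $A$ is separated if $H(A)=0$, and radical-full if $\mathfrak{m}A=A$. $\hat M=\varprojlim M/\mathfrak{m}^nM$, and $\operatorname{Ass}(\hat M)$ is the set of primes of $R$ associated to the $R$-module $\hat M$. $\operatorname{Koatt}(M)$ is the set of primes $\mathfrak{p}$ of $R$ such that $\mathfrak{p}=\operatorname{Ann}_R(U)$ for some submodule $U\subset M$. A pure submodule $A\subset B$ is pure-essential in $B$ if every submodule $X\subset B$ with $X\cap A=0$ and $(X\oplus A)/X$ pure in $B/X$ is zero. A pure-injective hull of $M$ is a pure-essential extension $M\subset N$ with $N$ pure-injective. *)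

(* Defs.v *)
From HB Require Import structures.
From mathcomp Require Import all_boot all_algebra.
From mathcomp Require Import generic_quotient ring_quotient.
From mathcomp Require Import finmap boolp monalg.

Set Implicit Arguments.
Unset Strict Implicit.
Unset Printing Implicit Defensive.

Import GRing.Theory.
Local Open Scope ring_scope.
Local Open Scope quotient_scope.

(* Submodules are the boolean predicates of the library structure             *)
(* submodClosed; an arbitrary (undecidable) membership proposition is turned  *)
(* into such a predicate with the classical `[< _ >], so no submodule is      *)
(* excluded.                                                                  *)

Section Span.
Context {R : pzRingType} {V : lmodType R}.

Definition span_pred (G : V -> Prop) : {pred V} :=
  fun x => `[< forall X : submodClosed V, (forall g, G g -> g \in X) -> x \in X >].

Lemma span_closed G : subsemimod_closed (span_pred G).
Proof.
apply: GRing.submod_closed_semi; split; first by apply/asboolP => X _; exact: rpred0.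
move=> a u v /asboolP Hu /asboolP Hv; apply/asboolP => X GX.
by rewrite rpredD ?rpredZ ?Hu ?Hv.
Qed.
HB.instance Definition _ G :=
  GRing.isSubmodClosed.Build R V (span_pred G) (span_closed G).

Definition span (G : V -> Prop) : submodClosed V := span_pred G.

Lemma mem_span (G : V -> Prop) g : G g -> g \in span G.
Proof. by move=> Gg; apply/asboolP => X; exact. Qed.

Lemma span_min (G : V -> Prop) (X : submodClosed V) :
  (forall g, G g -> g \in X) -> {subset span G <= X}.
Proof. by move=> GX x /asboolP; exact. Qed.

Lemma full_closed : subsemimod_closed (predT : {pred V}).
Proof. by []. Qed.
HB.instance Definition _ :=
  GRing.isSubmodClosed.Build R V predT full_closed.
Definition full : submodClosed V := predT.

Definition finitely_generated (X : submodClosed V) : Prop :=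
  exists s : seq V, X =i span (fun x => x \in s).

Definition sum_pred (X Y : submodClosed V) : {pred V} :=
  fun z => `[< exists2 x, x \in X & exists2 y, y \in Y & z = x + y >].

Lemma sum_closed X Y : subsemimod_closed (sum_pred X Y).
Proof.
apply: GRing.submod_closed_semi; split.
  by apply/asboolP; exists 0; rewrite ?rpred0 //; exists 0; rewrite ?rpred0 ?addr0.
move=> a _ _ /asboolP[x xX [y yY ->]] /asboolP[x' x'X [y' y'Y ->]].
apply/asboolP; exists (a *: x + x'); first by rewrite rpredD ?rpredZ.
exists (a *: y + y'); first by rewrite rpredD ?rpredZ.
by rewrite scalerDr addrACA.
Qed.
HB.instance Definition _ X Y :=
  GRing.isSubmodClosed.Build R V (sum_pred X Y) (sum_closed X Y).
Definition sum_sub (X Y : submodClosed V) : submodClosed V := sum_pred X Y.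

Definition direct_summand (X : submodClosed V) : Prop :=
  exists Y : submodClosed V,
    (forall x, x \in X -> x \in Y -> x = 0) /\ (forall x, x \in sum_sub X Y).

End Span.

Arguments full {R} V.

Section Image.
Context {R : pzRingType} {V W : lmodType R}.

Definition image_pred (f : {linear V -> W}) (X : submodClosed V) : {pred W} :=
  fun y => `[< exists2 x, x \in X & y = f x >].

Lemma image_closed f X : subsemimod_closed (image_pred f X).
Proof.
apply: GRing.submod_closed_semi; split.
  by apply/asboolP; exists 0; rewrite ?rpred0 ?linear0.
move=> a _ _ /asboolP[x xX ->] /asboolP[y yX ->]; apply/asboolP.
by exists (a *: x + y); rewrite ?linearP // rpredD ?rpredZ.
Qed.
HB.instance Definition _ f X :=
  GRing.isSubmodClosed.Build R W (image_pred f X) (image_closed f X).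
Definition image_sub (f : {linear V -> W}) (X : submodClosed V) : submodClosed W :=
  image_pred f X.

End Image.

Section SubmoduleAsModule.
Context {R : pzRingType} {V : lmodType R}.

Definition submod (X : submodClosed V) : Type := {x : V | x \in X}.
HB.instance Definition _ X := SubChoice.on (submod X).
HB.instance Definition _ (X : submodClosed V) :=
  GRing.SubChoice_isSubLmodule.Build R V (fun x => x \in X) (submod X)
    (GRing.subsemimodClosedP X).

Definition incl (X : submodClosed V) : {linear submod X -> V} := val.

End SubmoduleAsModule.

Section QuotientModule.
Context {R : pzRingType} {V : lmodType R} (X : submodClosed V).

(* SubmodClosed does not inherit from ZmodClosed, which Quotient.quot needs.  *)
Definition subgroup_pred : {pred V} := X.
Lemma subgroup_closed : zmod_closed subgroup_pred.
Proof. exact/GRing.submod_closedB/submodClosedP. Qed.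
HB.instance Definition _ := GRing.isZmodClosed.Build V subgroup_pred subgroup_closed.

Definition quotmod : Type := Quotient.quot subgroup_pred.
HB.instance Definition _ := GRing.Zmodule.on quotmod.
HB.instance Definition _ := EqQuotient.on quotmod.

Definition quot_pi : V -> quotmod := \pi_quotmod.

Lemma quot_piP x y : quot_pi x = quot_pi y <-> x - y \in X.
Proof.
rewrite /quot_pi; split => [/eqP|H]; last apply/eqP.
  by rewrite -(Quotient.idealrBE subgroup_pred).
by rewrite -(Quotient.idealrBE subgroup_pred).
Qed.

Lemma quot_pi_repr (x : quotmod) : quot_pi (repr x) = x.
Proof. exact: reprK. Qed.

Lemma quot_piB : {morph quot_pi : x y / x - y}.
Proof. exact: (raddfB (\pi_(Quotient.quot subgroup_pred) : {additive V -> _})). Qed.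
HB.instance Definition _ := GRing.isZmodMorphism.Build V quotmod quot_pi quot_piB.

Definition quot_scale (a : R) (x : quotmod) : quotmod := quot_pi (a *: repr x).

Lemma quot_scaleE a x : quot_scale a (quot_pi x) = quot_pi (a *: x).
Proof.
apply/quot_piP; rewrite -scalerBr rpredZ //; apply/quot_piP.
by rewrite quot_pi_repr.
Qed.

Lemma quot_scaleA a b x : quot_scale a (quot_scale b x) = quot_scale (a * b) x.
Proof. by rewrite -[x]quot_pi_repr !quot_scaleE scalerA. Qed.
Lemma quot_scale1 : left_id 1 quot_scale.
Proof. by move=> x; rewrite -[x]quot_pi_repr quot_scaleE scale1r. Qed.
Lemma quot_scaleDr : right_distributive quot_scale +%R.
Proof.
move=> a x y; rewrite -[x]quot_pi_repr -[y]quot_pi_repr.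
by rewrite -raddfD !quot_scaleE -raddfD scalerDr.
Qed.
Lemma quot_scaleDl x : {morph quot_scale^~ x : a b / a + b}.
Proof.
by move=> a b; rewrite -[x]quot_pi_repr !quot_scaleE -raddfD scalerDl.
Qed.
HB.instance Definition _ := GRing.Zmodule_isLmodule.Build R quotmod
  quot_scaleA quot_scale1 quot_scaleDr quot_scaleDl.

Lemma quot_piZ : scalable quot_pi.
Proof. by move=> a x; rewrite -quot_scaleE. Qed.
HB.instance Definition _ := GRing.isScalable.Build R V quotmod *:%R quot_pi quot_piZ.

End QuotientModule.

Definition isomorphic (R : pzRingType) (V W : lmodType R) : Prop :=
  exists f : {linear V -> W}, bijective f.

Section Kernel.
Context {R : pzRingType} {V W : lmodType R}.

Definition ker_pred (f : {linear V -> W}) : {pred V} := fun x => f x == 0.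

Lemma ker_closed f : subsemimod_closed (ker_pred f).
Proof.
apply: GRing.submod_closed_semi; split; first by rewrite unfold_in /ker_pred linear0.
move=> a x y; rewrite !unfold_in /ker_pred => /eqP fx /eqP fy.
by rewrite linearP fx fy scaler0 addr0.
Qed.
HB.instance Definition _ f :=
  GRing.isSubmodClosed.Build R V (ker_pred f) (ker_closed f).
Definition ker_sub (f : {linear V -> W}) : submodClosed V := ker_pred f.

Lemma mem_ker f x : (x \in ker_sub f) = (f x == 0).
Proof. by []. Qed.

End Kernel.

Section LinearExtension.
Context {R : comNzRingType} {K : choiceType} {V : lmodType R}.

Definition lin_ext (h : K -> V) (g : {malg R[K]}) : V :=
  \sum_(k <- msupp g) g@_k *: h k.

Lemma lin_ext_wider h (g : {malg R[K]}) (d : {fset K}) :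
  fsubset (msupp g) d -> lin_ext h g = \sum_(k <- d) g@_k *: h k.
Proof.
move=> sgd; rewrite /lin_ext (big_fset_incl _ sgd) //= => k _.
by move=> /mcoeff_outdom ->; rewrite scale0r.
Qed.

Lemma lin_ext_linear h : linear (lin_ext h).
Proof.
move=> a g1 g2.
pose d := fsetU (msupp g1) (fsetU (msupp g2) (msupp (a *: g1 + g2))).
have d1 : fsubset (msupp g1) d by exact: fsubsetUl.
have d2 : fsubset (msupp g2) d by rewrite /d fsetUCA fsubsetUl.
have d3 : fsubset (msupp (a *: g1 + g2)) d by rewrite /d fsetUA fsubsetUr.
rewrite (lin_ext_wider h d1) (lin_ext_wider h d2) (lin_ext_wider h d3).
rewrite scaler_sumr -big_split /=; apply: eq_bigr => k _.
by rewrite mcoeffD mcoeffZ scalerDl scalerA.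
Qed.
HB.instance Definition _ h :=
  GRing.isLinear.Build R {malg R[K]} V *:%R (lin_ext h) (lin_ext_linear h).

Lemma lin_extU h k : lin_ext h << k >> = h k.
Proof.
rewrite (@lin_ext_wider _ _ [fset k]%fset) ?msuppU_le //.
by rewrite big_seq_fset1 mcoeffUU scale1r.
Qed.

End LinearExtension.

(* The tensor product: the free module on A * B modulo the bilinearity        *)
(* relations.                                                                 *)
Section Tensor.
Context {R : comNzRingType}.

Variant tensor_rel (A B : lmodType R) : {malg R[(A * B)%type]} -> Prop :=
| TensorDl a a' b :
    tensor_rel (<< (a + a', b) >> - << (a, b) >> - << (a', b) >>)
| TensorDr a b b' :
    tensor_rel (<< (a, b + b') >> - << (a, b) >> - << (a, b') >>)
| TensorZl r a b : tensor_rel (<< (r *: a, b) >> - r *: << (a, b) >>)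
| TensorZr r a b : tensor_rel (<< (a, r *: b) >> - r *: << (a, b) >>).

Definition tensor (A B : lmodType R) : lmodType R :=
  quotmod (span (@tensor_rel A B)).

Definition tens {A B : lmodType R} (a : A) (b : B) : tensor A B :=
  quot_pi _ << (a, b) >>.

Lemma tensDl (A B : lmodType R) (a a' : A) (b : B) :
  tens (a + a') b = tens a b + tens a' b.
Proof.
rewrite /tens -raddfD; apply/quot_piP; rewrite opprD addrA.
exact/mem_span/TensorDl.
Qed.

Lemma tensDr (A B : lmodType R) (a : A) (b b' : B) :
  tens a (b + b') = tens a b + tens a b'.
Proof.
rewrite /tens -raddfD; apply/quot_piP; rewrite opprD addrA.
exact/mem_span/TensorDr.
Qed.

Lemma tensZl (A B : lmodType R) r (a : A) (b : B) :
  tens (r *: a) b = r *: tens a b.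
Proof. by rewrite /tens -linearZ; apply/quot_piP/mem_span/TensorZl. Qed.

Lemma tensZr (A B : lmodType R) r (a : A) (b : B) :
  tens a (r *: b) = r *: tens a b.
Proof. by rewrite /tens -linearZ; apply/quot_piP/mem_span/TensorZr. Qed.

Section Map.
Context {A A' : lmodType R} (f : {linear A -> A'}) (B : lmodType R).

Definition tensor_map (t : tensor A B) : tensor A' B :=
  lin_ext (fun ab => tens (f ab.1) ab.2) (repr t).

Lemma tensor_map_pi g :
  tensor_map (quot_pi _ g) = lin_ext (fun ab => tens (f ab.1) ab.2) g.
Proof.
pose h : {linear {malg R[(A * B)%type]} -> tensor A' B} :=
  lin_ext (fun ab => tens (f ab.1) ab.2).
rewrite -[LHS]/(h _) -[RHS]/(h g).
apply/eqP; rewrite -subr_eq0 -linearB -mem_ker.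
suff : repr (quot_pi _ g : tensor A B) - g \in span (@tensor_rel A B).
  apply: span_min => _ [a a' b|a b b'|r a b|r a b];
    rewrite mem_ker !linearB ?linearZ /= !lin_extU /=.
  - by rewrite linearD tensDl addrAC addrK subrr.
  - by rewrite tensDr addrAC addrK subrr.
  - by rewrite linearZ tensZl scalerN subrr.
  - by rewrite tensZr scalerN subrr.
by apply/quot_piP; rewrite quot_pi_repr.
Qed.

Lemma tensor_map_linear : linear tensor_map.
Proof.
move=> a x y; rewrite -[x]quot_pi_repr -[y]quot_pi_repr.
by rewrite -linearP !tensor_map_pi linearP.
Qed.
HB.instance Definition _ :=
  GRing.isLinear.Build R (tensor A B) (tensor A' B) *:%R tensor_map
    tensor_map_linear.

Lemma tensor_map_tens a b : tensor_map (tens a b) = tens (f a) b.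
Proof. by rewrite tensor_map_pi lin_extU. Qed.

End Map.

Arguments tensor_map {A A'} f B t.

Definition flat (F : lmodType R) : Prop :=
  forall (A B : lmodType R) (f : {linear A -> B}),
    injective f -> injective (tensor_map f F).

Definition pure (B : lmodType R) (A : submodClosed B) : Prop :=
  forall X : lmodType R, injective (tensor_map (incl A) X).

End Tensor.

Arguments tensor_map {R A A'} f B t.

Section PureInjective.
Context {R : comNzRingType}.

Definition pure_injective (N : lmodType R) : Prop :=
  forall (B : lmodType R) (A : submodClosed B) (h : {linear submod A -> N}),
    pure A -> exists g : {linear B -> N}, forall a, g (incl A a) = h a.

(* (X + A)/X is realized as the image of X + A under B -> B/X.                *)
Definition pure_essential (B : lmodType R) (A : submodClosed B) : Prop :=
  pure A /\
  forall X : submodClosed B,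
    (forall x, x \in X -> x \in A -> x = 0) ->
    pure (image_sub (quot_pi X) (sum_sub X A)) ->
    forall x, x \in X -> x = 0.

Definition pure_injective_hull (M N : lmodType R) (i : {linear M -> N}) : Prop :=
  [/\ injective i, pure_essential (image_sub i (full M)) & pure_injective N].

End PureInjective.

Section Ideals.
Context {R : comNzRingType}.

Definition noetherian : Prop :=
  forall I : submodClosed R^o, finitely_generated I.

(* idealr_closed includes properness. *)
Definition maximal_ideal (m : {pred R}) : Prop :=
  idealr_closed m /\
  forall I : {pred R}, idealr_closed I -> {subset m <= I} -> I =i m.

Definition local_ring (m : {pred R}) : Prop :=
  maximal_ideal m /\ forall m' : {pred R}, maximal_ideal m' -> m' =i m.

Definition prime_ideal (p : {pred R}) : Prop :=
  idealr_closed p /\ prime_idealr_closed p.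

Definition ann (V : lmodType R) (U : {pred V}) : {pred R} :=
  fun r => `[< forall u, u \in U -> r *: u = 0 >].

(* Sets of primes are predicates on {pred R} that depend only on membership.  *)
Definition Ass (V : lmodType R) (p : {pred R}) : Prop :=
  prime_ideal p /\ exists x : V, p =i ann (pred1 x).

Definition Koatt (V : lmodType R) (p : {pred R}) : Prop :=
  prime_ideal p /\ exists U : submodClosed V, p =i ann U.

Definition ideal_mul (I : {pred R}) (V : lmodType R) (A : submodClosed V) :
    submodClosed V :=
  span (fun x => exists2 r, r \in I & exists2 a, a \in A & x = r *: a).

Fixpoint ideal_pow (m : {pred R}) (n : nat) : submodClosed R^o :=
  if n is n'.+1 then ideal_mul m (ideal_pow m n') else full R^o.

End Ideals.

Arguments noetherian : clear implicits.

Section Adic.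
Context {R : comNzRingType} (m : {pred R}) (V : lmodType R).

Definition adic (n : nat) : submodClosed V := ideal_mul (ideal_pow m n) (full V).

Definition H_pred : {pred V} :=
  fun x => `[< forall n, (1 <= n)%N -> x \in adic n >].

Lemma H_closed : subsemimod_closed H_pred.
Proof.
apply: GRing.submod_closed_semi; split; first by apply/asboolP => n _; exact: rpred0.
move=> a x y /asboolP Hx /asboolP Hy; apply/asboolP => n n_gt0.
by rewrite rpredD ?rpredZ ?Hx ?Hy.
Qed.
HB.instance Definition _ := GRing.isSubmodClosed.Build R V H_pred H_closed.
Definition H : submodClosed V := H_pred.

Definition separated : Prop := forall x, x \in H -> x = 0.

Definition radical_full : Prop := ideal_mul m (full V) =i full V.

End Adic.

Section Product.
Context {R : pzRingType} {I : Type} (V : I -> lmodType R).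

Definition prodmod : Type := forall i, V i.
HB.instance Definition _ := gen_eqMixin prodmod.
HB.instance Definition _ := gen_choiceMixin prodmod.

Let add (f g : prodmod) : prodmod := fun i => f i + g i.
Let opp (f : prodmod) : prodmod := fun i => - f i.
Let zero : prodmod := fun i => 0.
Let scale (a : R) (f : prodmod) : prodmod := fun i => a *: f i.

Let addA : associative add.
Proof. by move=> f g h; apply: functional_extensionality_dep => i; exact: addrA. Qed.
Let addC : commutative add.
Proof. by move=> f g; apply: functional_extensionality_dep => i; exact: addrC. Qed.
Let add0 : left_id zero add.
Proof. by move=> f; apply: functional_extensionality_dep => i; exact: add0r. Qed.
Let addN : left_inverse zero opp add.
Proof. by move=> f; apply: functional_extensionality_dep => i; exact: addNr. Qed.
HB.instance Definition _ := GRing.isZmodule.Build prodmod addA addC add0 addN.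

Let scaleA a b f : scale a (scale b f) = scale (a * b) f.
Proof. by apply: functional_extensionality_dep => i; exact: scalerA. Qed.
Let scale1 : left_id 1 scale.
Proof. by move=> f; apply: functional_extensionality_dep => i; exact: scale1r. Qed.
Let scaleDr : right_distributive scale +%R.
Proof. by move=> a f g; apply: functional_extensionality_dep => i; exact: scalerDr. Qed.
Let scaleDl f : {morph scale^~ f : a b / a + b}.
Proof. by move=> a b; apply: functional_extensionality_dep => i; exact: scalerDl. Qed.
HB.instance Definition _ :=
  GRing.Zmodule_isLmodule.Build R prodmod scaleA scale1 scaleDr scaleDl.

End Product.

Section Completion.
Context {R : comNzRingType} (m : {pred R}) (V : lmodType R).

Lemma adicS n : {subset adic m V n.+1 <= adic m V n}.
Proof.
apply: span_min => _ [r rI [v _ ->]]; apply: mem_span.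
exists r; last by exists v.
move: rI; apply: (@span_min _ R^o) => _ [s _ [t tI ->]].
exact: rpredZ.
Qed.

Definition adic_proj n (x : quotmod (adic m V n.+1)) : quotmod (adic m V n) :=
  quot_pi _ (repr x).

Lemma adic_proj_pi n x : @adic_proj n (quot_pi _ x) = quot_pi _ x.
Proof. by apply/quot_piP/adicS/quot_piP; rewrite quot_pi_repr. Qed.

Lemma adic_proj_linear n : linear (@adic_proj n).
Proof.
move=> a x y; rewrite -[x]quot_pi_repr -[y]quot_pi_repr.
by rewrite -linearP !adic_proj_pi linearP.
Qed.
HB.instance Definition _ n :=
  GRing.isLinear.Build R _ _ *:%R (@adic_proj n) (@adic_proj_linear n).

Definition compat_pred : {pred prodmod (fun n => quotmod (adic m V n))} :=
  fun f => `[< forall n, adic_proj (f n.+1) = f n >].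

Lemma compat_closed : subsemimod_closed compat_pred.
Proof.
apply: GRing.submod_closed_semi; split.
  by apply/asboolP => n; exact: linear0.
move=> a f g /asboolP cf /asboolP cg; apply/asboolP => n.
rewrite -[RHS]/(a *: f n + g n) -cf -cg.
exact: linearP.
Qed.
HB.instance Definition _ :=
  GRing.isSubmodClosed.Build R _ compat_pred compat_closed.

(* The inverse limit of the V/m^n V; the index n = 0 adds only the zero       *)
(* module V/m^0 V.                                                            *)
Definition completion : lmodType R := submod compat_pred.

End Completion.

(* Main.v *)
Require Import Defs.
From HB Require Import structures.
From mathcomp Require Import all_boot all_algebra.
From mathcomp Require Import finmap monalg boolp.
From mathcomp Require classical_sets.
Import GRing.Theory.

(* Purity is solvability of finite systems of linear equations, and a         *)
(* pure-injective module solves every system that is finitely solvable. By    *)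
(* the Ellis-Numakura argument (compactness being algebraic compactness) the  *)
(* endomorphisms of N over M form a semigroup in which every left ideal has   *)
(* an idempotent; pure-essentiality makes it the identity, so every           *)
(* endomorphism e of N with e i = i is bijective.                             *)
(* Let L be the flat completion of M. For an ideal I, I L is closed (a weak   *)
(* Artin-Rees lemma), and the R/m^n are artinian, so families of cosets of    *)
(* such submodules with the finite intersection property meet; hence M -> L   *)
(* extends to g : N -> L. The free module F on a lift of a basis of M/mM is   *)
(* pure in L, so F -> M -> N extends to h : L -> N, and g h = 1. On M the     *)
(* map i - h g i takes values in mN, which is again algebraically compact, so *)
(* it extends to d : N -> mN. Now e = h g + d fixes M and e N lies in M + mN; *)
(* since e is onto, N = M + mN. It follows that ker g = m ker g, that is      *)
(* ker g = H(N), and N = H(N) + h L is a direct sum. Finally Ass(L) and       *)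
(* Koatt(M) both consist of the primes Ann(a), a in R, when M is nonzero.     *)

(** Parts (a) and (b) come from one split surjection. [hull_splitting] gives g : N -> L extending
    the canonical map of M, and h : L -> N with g h = 1, so that N is the direct sum of ker g and h
    L; it remains to see that ker g = H(N). As L is separated, H(N) lies in ker g; the converse
    ([hull_H]) rests on N = M + mN ([hull_sum_ideal_mul]), which also says that N/M is radical-full.
    The map g is obtained by a compactness argument for flat completions ([flat_completion_ext]):
    flatness turns the values allowed by a finite system of equations into a coset of I L with I an
    ideal ([solves_homogeneous_mem]), and directed families of such cosets meet ([coset_inter]). The
    map h exists because N is pure-injective and the free module F is pure in L ([basis_eqpure]).
    Essentiality of the hull enters through [hull_endo_surj] alone. For (c), a prime that
    annihilates a subset of a flat module is the annihilator of a ring element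
    ([prime_annihilator_ring]); conversely an element of M with zero annihilator ([regular_element])
    realizes such a prime in M and in L. *)

Set Implicit Arguments.
Unset Strict Implicit.
Unset Printing Implicit Defensive.
Local Open Scope ring_scope.
Local Notation span := Defs.span.

(** * Linear maps, quotients and tensors *)

Section Modules.
Context {R : comNzRingType}.

Lemma mk_linear (V W : lmodType R) (f : V -> W) :
  linear f -> exists F : {linear V -> W}, F =1 f.
Proof.
move=> fl; pose m := GRing.isLinear.Build R V W *:%R f fl.
by exists (HB.pack_for {linear V -> W} f m).
Qed.

Section MkSub.
Context {V : lmodType R} (P : V -> Prop).
(** The closure proofs are arguments so that the submodule instance can be attached to the predicate
    for an arbitrary [P]. *)
Definition sub_pred (_ : P 0) (_ : forall a u v, P u -> P v -> P (a *: u + v)) :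
  {pred V} := fun x => `[< P x >].
Lemma sub_pred_closed P0 PD : subsemimod_closed (sub_pred P0 PD).
Proof.
apply: GRing.submod_closed_semi; split; first by apply/asboolP.
by move=> a u v /asboolP Pu /asboolP Pv; apply/asboolP/PD.
Qed.
HB.instance Definition _ P0 PD :=
  GRing.isSubmodClosed.Build R V (sub_pred P0 PD) (sub_pred_closed P0 PD).
Definition sub_of P0 PD : submodClosed V := sub_pred P0 PD.
Lemma mk_sub : P 0 -> (forall a u v, P u -> P v -> P (a *: u + v)) ->
  exists X : submodClosed V, forall x, x \in X <-> P x.
Proof. by move=> P0 PD; exists (sub_of P0 PD) => x; split => /asboolP. Qed.
End MkSub.

Lemma span_ind (V : lmodType R) (G P : V -> Prop) : P 0 ->
  (forall a u v, P u -> P v -> P (a *: u + v)) -> (forall g, G g -> P g) ->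
  forall x, x \in span G -> P x.
Proof.
move=> P0 PD GP x xG; have [X XP] := mk_sub P0 PD.
by apply/XP; apply: span_min x xG => g /GP/XP.
Qed.

Lemma rpredBs (V : lmodType R) (X : submodClosed V) x y :
  x \in X -> y \in X -> x - y \in X.
Proof. by move=> xX yX; rewrite rpredD // -scaleN1r rpredZ. Qed.

Lemma mem_full (V : lmodType R) (x : V) : x \in full V.
Proof. by []. Qed.

Lemma mem_image_sub (V W : lmodType R) (f : {linear V -> W}) (X : submodClosed V) x :
  x \in X -> f x \in image_sub f X.
Proof. by move=> xX; apply/asboolP; exists x. Qed.

Lemma image_subP (V W : lmodType R) (f : {linear V -> W}) (X : submodClosed V) y :
  y \in image_sub f X -> exists2 x, x \in X & y = f x.
Proof. by move=> /asboolP. Qed.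

Lemma mem_sum_sub (V : lmodType R) (X Y : submodClosed V) x y :
  x \in X -> y \in Y -> x + y \in sum_sub X Y.
Proof. by move=> xX yY; apply/asboolP; exists x => //; exists y. Qed.

Lemma mem_sum_subl (V : lmodType R) (X Y : submodClosed V) x :
  x \in X -> x \in sum_sub X Y.
Proof. by move=> xX; rewrite -[x]addr0 mem_sum_sub ?rpred0. Qed.

Lemma mem_sum_subr (V : lmodType R) (X Y : submodClosed V) y :
  y \in Y -> y \in sum_sub X Y.
Proof. by move=> yY; rewrite -[y]add0r mem_sum_sub ?rpred0. Qed.

Lemma sum_subP (V : lmodType R) (X Y : submodClosed V) z : z \in sum_sub X Y ->
  exists x y, [/\ x \in X, y \in Y & z = x + y].
Proof. by move=> /asboolP[x xX [y yY ->]]; exists x, y. Qed.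

Lemma quot_pi0 (V : lmodType R) (X : submodClosed V) x :
  quot_pi X x = 0 <-> x \in X.
Proof. by rewrite -(linear0 (quot_pi X)) quot_piP subr0. Qed.

Lemma quot_lift (V W : lmodType R) (X : submodClosed V) (f : {linear V -> W}) :
  (forall x, x \in X -> f x = 0) ->
  exists F : {linear quotmod X -> W}, forall v, F (quot_pi X v) = f v.
Proof.
move=> fX; pose F (q : quotmod X) := f (repr q).
have FE v : F (quot_pi X v) = f v.
  apply/eqP; rewrite /F -subr_eq0 -linearB fX //.
  by apply/quot_piP; rewrite quot_pi_repr.
have [|G GE] := @mk_linear (quotmod X) W F.
  move=> a x y; rewrite -[x]quot_pi_repr -[y]quot_pi_repr -linearP !FE.
  exact: linearP.
by exists G => v; rewrite GE FE.
Qed.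

Lemma quot_pi_surj (V : lmodType R) (X : submodClosed V) (q : quotmod X) :
  exists v, q = quot_pi X v.
Proof. by exists (repr q); rewrite quot_pi_repr. Qed.

Section LinExt.
Context {K : choiceType} {V W : lmodType R}.
Implicit Types (h : K -> V) (g : {malg R[K]}).

Lemma lin_ext_comp (f : {linear V -> W}) h g :
  f (lin_ext h g) = lin_ext (f \o h) g.
Proof. by rewrite /lin_ext linear_sum; apply: eq_bigr => k _; exact: linearZ. Qed.

Lemma eq_lin_ext h h' g :
  (forall k, k \in msupp g -> h k = h' k) -> lin_ext h g = lin_ext h' g.
Proof. by move=> hh; rewrite /lin_ext; apply: eq_big_seq => k /hh ->. Qed.

Lemma lin_ext_combine a h h' g :
  lin_ext (fun k => a *: h k + h' k) g = a *: lin_ext h g + lin_ext h' g.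
Proof.
rewrite /lin_ext scaler_sumr -big_split /=; apply: eq_bigr => k _.
by rewrite scalerDr !scalerA mulrC.
Qed.

Lemma lin_ext0 g : lin_ext (fun _ : K => 0 : V) g = 0.
Proof. by rewrite /lin_ext big1 // => k _; rewrite scaler0. Qed.
End LinExt.

Lemma lin_ext_sub (K L : choiceType) (V : lmodType R) (h : L -> V)
    (u : K -> {malg R[L]}) g :
  lin_ext h (lin_ext u g) = lin_ext (fun k => lin_ext h (u k)) g.
Proof. exact: lin_ext_comp. Qed.

Lemma lin_extD (K : choiceType) (V : lmodType R) (h h' : K -> V) g :
  lin_ext (fun k => h k + h' k) g = lin_ext h g + lin_ext h' g.
Proof.
rewrite -[X in _ = X + _]scale1r -lin_ext_combine.
by apply: eq_lin_ext => k _; rewrite scale1r.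
Qed.

Lemma lin_ext_id (K : choiceType) (g : {malg R[K]}) : lin_ext (fun k => << k >>) g = g.
Proof.
rewrite [RHS]monalgE /lin_ext; apply: eq_bigr => k _.
by apply/malgP => k'; rewrite mcoeffZ !mcoeffU mulrnAr mulr1.
Qed.

Lemma lin_ext_single (K : choiceType) (V : lmodType R) (k0 : K) (v : V) g :
  lin_ext (fun k => if k == k0 then v else 0) g = g@_k0 *: v.
Proof.
rewrite (@lin_ext_wider _ _ _ _ _ (fsetU (msupp g) [fset k0]%fset)) ?fsubsetUl //.
rewrite (big_fsetD1 k0) ?inE ?eqxx ?orbT //= big1_fset ?addr0 //.
by move=> k; rewrite !inE => /andP[/negPf -> _] _; rewrite scaler0.
Qed.

Lemma tens_lift (A B C : lmodType R) (b : A -> B -> C) :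
  (forall x, linear (b x)) -> (forall y, linear (b^~ y)) ->
  exists F : {linear tensor A B -> C}, forall x y, F (tens x y) = b x y.
Proof.
move=> bl br.
have bD x y y' : b x (y + y') = b x y + b x y'.
  by have := bl x 1 y y'; rewrite !scale1r.
have bD' x x' y : b (x + x') y = b x y + b x' y.
  by have := br y 1 x x'; rewrite !scale1r.
have b0 x : b x 0 = 0 by apply: (addrI (b x 0)); rewrite -bD !addr0.
have b0' y : b 0 y = 0 by apply: (addrI (b 0 y)); rewrite -bD' !addr0.
have bZ a x y : b x (a *: y) = a *: b x y.
  by have := bl x a y 0; rewrite b0 !addr0.
have bZ' a x y : b (a *: x) y = a *: b x y.
  by have := br y a x 0; rewrite b0' !addr0.
pose h : {linear {malg R[(A * B)%type]} -> C} := lin_ext (fun ab => b ab.1 ab.2).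
have [|F FE] := @quot_lift _ _ (span (@tensor_rel R A B)) h.
  move=> x /(span_min (X := ker_sub h)) xk; apply/eqP.
  rewrite -mem_ker; apply: xk => _ [a a' c|a c c'|r a c|r a c];
    rewrite mem_ker !linearB ?linearZ /= !lin_extU /=.
  - by rewrite bD' addrAC addrK subrr.
  - by rewrite bD addrAC addrK subrr.
  - by rewrite bZ' scalerN subrr.
  - by rewrite bZ scalerN subrr.
by exists F => x y; rewrite [LHS]FE /h /= lin_extU.
Qed.

Section TensLinear.
Context {A B : lmodType R}.
Lemma tens_linl (b : B) : linear (fun a : A => tens a b).
Proof. by move=> r x y; rewrite tensDl tensZl. Qed.
Lemma tens_linr (a : A) : linear (fun b : B => tens a b).
Proof. by move=> r x y; rewrite tensDr tensZr. Qed.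

Lemma tens_suml I (r : seq I) (P : pred I) (f : I -> A) (b : B) :
  tens (\sum_(i <- r | P i) f i) b = \sum_(i <- r | P i) tens (f i) b.
Proof.
have [F FE] := mk_linear (tens_linl b).
by rewrite -[LHS]FE linear_sum; apply: eq_bigr => i _; rewrite FE.
Qed.
Lemma tens_sumr I (r : seq I) (P : pred I) (f : I -> B) (a : A) :
  tens a (\sum_(i <- r | P i) f i) = \sum_(i <- r | P i) tens a (f i).
Proof.
have [F FE] := mk_linear (tens_linr a).
by rewrite -[LHS]FE linear_sum; apply: eq_bigr => i _; rewrite FE.
Qed.
Lemma tens0r (a : A) : tens a (0 : B) = 0.
Proof. by rewrite -(scale0r (0 : B)) tensZr scale0r. Qed.
End TensLinear.

End Modules.

(** * Purity and systems of linear equations *)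

Section Equations.
Context {R : comNzRingType}.

(** A left-hand side is a linear form, an element of the free module on the unknowns [J];
    [lin_ext h] evaluates it at the assignment [h]. Only finitely many unknowns occur in a list,
    however large [J] is. *)
Definition eqns (J : choiceType) (V : lmodType R) := seq ({malg R[J]} * V)%type.

Definition solves (J : choiceType) (V : lmodType R) (h : J -> V) (l : eqns J V) :=
  forall e, e \in l -> lin_ext h e.1 = e.2.

Definition eqpure (B : lmodType R) (A : submodClosed B) : Prop :=
  forall (J : choiceType) (l : eqns J B), (forall e, e \in l -> e.2 \in A) ->
  (exists h, solves h l) -> exists2 h, forall j, h j \in A & solves h l.

Lemma prodE (I : Type) (V : I -> lmodType R) (f g : prodmod V) i : (f + g) i = f i + g i.
Proof. by []. Qed.

Lemma prodZE (I : Type) (V : I -> lmodType R) a (f : prodmod V) i : (a *: f) i = a *: f i.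
Proof. by []. Qed.

Lemma prod_sumE (I : Type) (V : I -> lmodType R) K (r : seq K) (P : pred K)
    (F : K -> prodmod V) i : (\sum_(k <- r | P k) F k) i = \sum_(k <- r | P k) F k i.
Proof. by elim/big_rec2: _ => // k x y _ <-. Qed.

Definition unit_vec k (i : 'I_k) : prodmod (fun _ : 'I_k => R^o) :=
  fun i' => (i == i')%:R.

Lemma unit_vec_sum k (v : prodmod (fun _ : 'I_k => R^o)) :
  v = \sum_i (v i : R) *: unit_vec i.
Proof.
apply: functional_extensionality_dep => i; rewrite prod_sumE.
rewrite (bigD1 i) //= big1 ?addr0 => [|i' /negPf ne].
  by rewrite prodZE /unit_vec eqxx [_ *: _]mulr1.
by rewrite prodZE /unit_vec ne [_ *: _]mulr0.
Qed.

(** Tensor with X = R^k/U, where U is spanned by the columns of the system. A solution in B makes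
    the tensor [t] of the right-hand sides vanish over B, hence over A by purity. *)
Lemma pure_eqpure (B : lmodType R) (A : submodClosed B) : pure A -> eqpure A.
Proof.
move=> pA J l lA [h hl].
pose k := size l.
pose g (i : 'I_k) : {malg R[J]} := (tnth (in_tuple l) i).1.
have aA (i : 'I_k) : (tnth (in_tuple l) i).2 \in A by apply/lA/mem_tnth.
pose a (i : 'I_k) : submod A := exist (fun x => x \in A) _ (aA i).
have hg i : lin_ext h (g i) = val (a i) by apply/hl/mem_tnth.
pose V : lmodType R := prodmod (fun _ : 'I_k => R^o).
pose u j : V := fun i => (g i)@_j.
pose U := span (fun v : V => exists j, v = u j).
pose X : lmodType R := quotmod U.
pose t : tensor (submod A) X := \sum_i tens (a i) (quot_pi U (unit_vec i) : X).
have t0 : t = 0.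
  apply: (pA X); rewrite linear0 linear_sum.
  pose d := (\bigcup_(i <- enum 'I_k) msupp (g i))%fset.
  transitivity (\sum_i \sum_(j <- d) (g i)@_j *: tens (h j) (quot_pi U (unit_vec i) : X)).
    apply: eq_bigr => i _; rewrite [LHS]tensor_map_tens -[incl A _]/(val (a i)) -hg.
    rewrite (@lin_ext_wider _ _ _ _ _ d); last by apply: bigfcup_sup; rewrite ?mem_enum.
    by rewrite tens_suml; apply: eq_bigr => j _; rewrite tensZl.
  rewrite exchange_big big1 //= => j _.
  transitivity (tens (h j) (quot_pi U (u j) : X)).
    rewrite [u j]unit_vec_sum linear_sum tens_sumr; apply: eq_bigr => i _.
    by rewrite linearZ tensZr.
  suff -> : quot_pi U (u j) = 0 by exact: tens0r.
  by apply/quot_pi0/mem_span; exists j.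
(* [T] collects the right-hand sides solvable in A. The tensor product of A and X maps to A^k modulo
   [T], sending [t] to the class of the given right-hand sides; so t = 0 makes these solvable. *)
pose W : lmodType R := prodmod (fun _ : 'I_k => submod A).
have [||T TP] := @mk_sub R W
   (fun w => exists h' : J -> submod A, forall i, w i = lin_ext h' (g i)).
- by exists (fun=> 0) => i; rewrite lin_ext0.
- move=> r w w' [h1 H1] [h2 H2]; exists (fun j => r *: h1 j + h2 j) => i.
  by rewrite lin_ext_combine prodE prodZE H1 H2.
pose bb (x : submod A) (v : V) : W := fun i => (v i : R) *: x.
have bbD x v v' : bb x (v + v') = bb x v + bb x v'.
  by apply: functional_extensionality_dep => i; rewrite /bb prodE scalerDl.
have bbZ x r v : bb x (r *: v) = r *: bb x v.
  by apply: functional_extensionality_dep => i; exact: esym (scalerA r (v i : R) x).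
have bU x v : v \in U -> bb x v \in T.
  move: v; apply: span_ind.
  - have -> : bb x 0 = 0.
      by apply: functional_extensionality_dep => i; rewrite /bb scale0r.
    exact: rpred0.
  - by move=> r v v' v1 v2; rewrite bbD bbZ rpredD ?rpredZ.
  - move=> _ [j ->]; apply/TP; exists (fun j' => if j' == j then x else 0) => i.
    by rewrite lin_ext_single.
pose b (x : submod A) (q : X) : quotmod T := quot_pi T (bb x (repr (q : quotmod U))).
have bE x v : b x (quot_pi U v) = quot_pi T (bb x v).
  apply/quot_piP; rewrite -[- bb x v]scaleN1r -bbZ -bbD; apply: bU.
  by rewrite scaleN1r; apply/quot_piP; rewrite quot_pi_repr.
have [||F FE] := @tens_lift R (submod A) X (quotmod T) b.
- move=> x r q q'; have [v ->] := quot_pi_surj q; have [v' ->] := quot_pi_surj q'.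
  by rewrite -linearP !bE bbD bbZ linearP.
- move=> q r x x'; have [v ->] := quot_pi_surj q.
  rewrite !bE -linearP; congr (quot_pi _ _).
  apply: functional_extensionality_dep => i; rewrite prodE prodZE /bb.
  by rewrite scalerDr !scalerA mulrC.
have : F t = 0 by rewrite t0 linear0.
rewrite linear_sum.
have -> : \sum_i F (tens (a i) (quot_pi U (unit_vec i) : X)) = quot_pi T (a : W).
  transitivity (\sum_i quot_pi T (bb (a i) (unit_vec i))).
    by apply: eq_bigr => i _; rewrite FE bE.
  rewrite -linear_sum; congr (quot_pi _ _).
  apply: functional_extensionality_dep => i; rewrite prod_sumE.
  rewrite (bigD1 i) //= big1 ?addr0 => [|i' /negPf ne].
    by rewrite /bb /unit_vec eqxx scale1r.
  by rewrite /bb /unit_vec ne scale0r.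
move=> /quot_pi0/TP[h' h'E]; exists (val \o h'); first by move=> j; exact: valP.
move=> e el; have [i ei] := (tnthP (in_tuple l) e el).
rewrite -(lin_ext_comp (incl A)) ei -[(tnth _ i).1]/(g i) -h'E //.
Qed.

(** Finite choice along a list, used to replace a finite system by a system of witnesses. *)
Lemma lift_list (S T : eqType) (Q : S -> T -> Prop) (l : seq T) :
  (forall t, t \in l -> exists s, Q s t) ->
  exists2 l' : seq S, forall s, s \in l' -> exists2 t, t \in l & Q s t &
    forall t, t \in l -> exists2 s, s \in l' & Q s t.
Proof.
elim: l => [_|t l IH H]; first by exists [::].
have [|l' H1 H2] := IH; first by move=> u ul; apply: H; rewrite inE ul orbT.
have [s st] := H t (mem_head _ _).
exists (s :: l') => [s'|t']; rewrite inE => /orP[/eqP ->|].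
- by exists t; rewrite ?mem_head.
- by move=> /H1[u ul su]; exists u; rewrite // inE ul orbT.
- by exists s; rewrite ?mem_head.
- by move=> /H2[u ul su]; exists u; rewrite // inE ul orbT.
Qed.

(** That a tensor vanishes over B is witnessed by finitely many linear identities between elements
    of B. Purity replaces these elements by elements of A that satisfy the same identities, and so
    the tensor vanishes over A. *)
Lemma eqpure_pure (B : lmodType R) (A : submodClosed B) : eqpure A -> pure A.
Proof.
move=> eA X.
suff ker0 t : tensor_map (incl A) X t = 0 -> t = 0.
  move=> t1 t2 e; apply/eqP; rewrite -subr_eq0; apply/eqP/ker0.
  by rewrite linearB [X in X - _]e subrr.
move=> tt0; have [g tE] := quot_pi_surj t.
pose g' := lin_ext (fun ab : submod A * X => << (incl A ab.1, ab.2) >> : {malg R[(B * X)%type]}) g.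
have g'S : g' \in span (@tensor_rel R B X).
  apply/quot_pi0; rewrite lin_ext_comp.
  by move: tt0; rewrite tE tensor_map_pi.
(* [E] records the identities in B behind the relations that make up [u]; any assignment [rho] into
   A respecting them carries [u] to zero over A. *)
have cert u : u \in span (@tensor_rel R B X) -> exists2 E : seq {malg R[B]},
    forall e, e \in E -> lin_ext (id : B -> B) e = 0 &
    forall rho : B -> submod A, (forall e, e \in E -> lin_ext rho e = 0) ->
      lin_ext (fun bx => tens (rho bx.1) bx.2) u = 0.
  move: u; apply: span_ind; first by exists [::] => // rho _; rewrite linear0.
    move=> a u v [E1 H1 K1] [E2 H2 K2]; exists (E1 ++ E2).
      by move=> e; rewrite mem_cat => /orP[/H1|/H2].
    move=> rho H; rewrite lin_ext_linear K1 ?K2 ?scaler0 ?addr0 // => e ee;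
      by apply: H; rewrite mem_cat ee ?orbT.
  move=> _ [a a' b|a b b'|r a b|r a b].
  - exists [:: << a + a' >> - << a >> - << a' >>].
      move=> e; rewrite inE => /eqP ->.
      by rewrite !linearB /= !lin_extU addrAC addrK subrr.
    move=> rho /(_ _ (mem_head _ _)); rewrite !linearB /= !lin_extU /= => H.
    have -> : rho (a + a') = rho a + rho a'.
      by apply/eqP; rewrite -subr_eq0 opprD addrA H.
    by rewrite tensDl addrAC addrK subrr.
  - exists [::] => // rho _; rewrite !linearB /= !lin_extU /= tensDr.
    by rewrite addrAC addrK subrr.
  - exists [:: << r *: a >> - r *: << a >>].
      move=> e; rewrite inE => /eqP ->.
      by rewrite linearB linearZ /= !lin_extU subrr.
    move=> rho /(_ _ (mem_head _ _)); rewrite linearB linearZ /= !lin_extU => H.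
    have rhoZ : rho (r *: a) = r *: rho a by apply/eqP; rewrite -subr_eq0 H.
    by rewrite linearB linearZ /= !lin_extU /= rhoZ tensZl subrr.
  - exists [::] => // rho _; rewrite !linearB linearZ /= !lin_extU /= tensZr.
    by rewrite subrr.
have [E H K] := cert _ g'S.
(* The unknowns are the elements of B. They must satisfy the identities in [E], and the elements of
   A that occur in [g] must keep their values; the identity solves this in B. *)
pose l : eqns B B := [seq (e, 0) | e <- E] ++
  [seq (<< val (ax : submod A * X).1 >>, val ax.1) | ax <- msupp g].
have [| |h hA hl] := eA B l.
- move=> e; rewrite mem_cat => /orP[/mapP[u _ ->]|/mapP[ax _ ->]] /=.
    exact: rpred0.
  exact: valP.
- exists id => e; rewrite mem_cat => /orP[/mapP[u /H uE ->]|/mapP[ax _ ->]] //=.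
  by rewrite lin_extU.
pose rho b : submod A := exist (fun x => x \in A) (h b) (hA b).
have : lin_ext (fun bx => tens (rho bx.1) bx.2) g' = 0.
  apply: K => e eE; apply: val_inj; rewrite [LHS](lin_ext_comp (incl A)) linear0.
  apply: (hl (e, 0)); rewrite mem_cat; apply/orP; left.
  by apply/mapP; exists e.
rewrite lin_ext_sub => gE; rewrite tE -[g]lin_ext_id lin_ext_comp -[RHS]gE.
apply: eq_lin_ext => -[a x] ag /=; rewrite lin_extU /tens /=; congr (quot_pi _ << (_, _) >>).
apply: val_inj => /=; rewrite /incl /=.
have := hl (<< val a >>, val a); rewrite /= lin_extU => -> //.
rewrite mem_cat; apply/orP; right; apply/mapP; exists (a, x) => //.
Qed.

Lemma pure_ext (N A B : lmodType R) (j : {linear A -> B}) (f : {linear A -> N}) :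
  pure_injective N -> injective j -> pure (image_sub j (full A)) ->
  exists g : {linear B -> N}, forall a, g (j a) = f a.
Proof.
move=> pN ji jp; pose A' := image_sub j (full A).
have inv0 (y : submod A') : exists x, val y = j x.
  by have [x _ ->] := image_subP (valP y); exists x.
have [inv invE] := choice inv0.
have invl : linear inv by move=> a x y; apply: ji; rewrite linearP -!invE.
have [v vE] := mk_linear invl.
have [g gE] := pN B A' (f \o v : {linear submod A' -> N}) jp.
exists g => a; have ja : j a \in A' by exact: mem_image_sub.
have := gE (exist (fun x => x \in A') _ ja).
rewrite -[incl _ _]/(j a) => ->; rewrite /= vE; congr (f _).
by apply: ji; rewrite -invE.
Qed.

Definition alg_compact (V : lmodType R) : Prop :=
  forall (J : choiceType) (E : {malg R[J]} -> V -> Prop),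
  (forall l : eqns J V, (forall e, e \in l -> E e.1 e.2) -> exists h, solves h l) ->
  exists h : J -> V, forall g a, E g a -> lin_ext h g = a.

(** Adjoin a universal solution: B is N plus the free module on [J], modulo all equations. Finite
    solvability makes N -> B injective and pure, and a retraction B -> N carries the universal
    solution into N. *)
Lemma pinj_alg_compact (N : lmodType R) : pure_injective N -> alg_compact N.
Proof.
move=> pN J E finE.
pose P : lmodType R := (N * {malg R[J]})%type.
pose W := span (fun w : P => exists g a, E g a /\ w = (a, - g)).
have theta (x : J -> N) : exists F : {linear P -> N},
    forall w, F w = w.1 + lin_ext x w.2.
  apply: mk_linear => a w w' /=.
  by rewrite linearP /= scalerDr addrACA.
have cert w : w \in W -> exists2 l : eqns J N, forall e, e \in l -> E e.1 e.2 &
    forall x, solves x l -> w.1 + lin_ext x w.2 = 0.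
  move: w; apply: span_ind.
  - by exists [::] => // x _ /=; rewrite linear0 addr0.
  - move=> a u v [l1 H1 K1] [l2 H2 K2]; exists (l1 ++ l2).
      by move=> e; rewrite mem_cat => /orP[/H1|/H2].
    move=> x xl; have [F FE] := theta x; rewrite -FE linearP !FE K1 ?K2 ?scaler0 ?addr0 //;
      by move=> e el; apply: xl; rewrite mem_cat el ?orbT.
  - move=> _ [g [a [Ega ->]]]; exists [:: (g, a)].
      by move=> e; rewrite inE => /eqP ->.
    by move=> x /(_ _ (mem_head _ _)) /= xE; rewrite linearN /= xE subrr.
pose B : lmodType R := quotmod W.
have [|j jE] := @mk_linear R N B (fun n => quot_pi W (n, 0)).
  move=> a n n'; rewrite -linearP; congr (quot_pi _ _).
  by apply: injective_projections; rewrite /= ?scaler0 ?addr0.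
have jW n w : quot_pi W w = j n <-> w - (n, 0) \in W by rewrite jE quot_piP.
have ji : injective j.
  move=> n n' e; apply/eqP; rewrite -subr_eq0; apply/eqP.
  have : j (n - n') = 0 by rewrite linearB e subrr.
  rewrite jE => /quot_pi0/cert[l lE lx].
  have [x xl] := finE l lE.
  by have := lx x xl; rewrite /= linear0 addr0.
have jp : pure (image_sub j (full N)).
  (* Each equation holds in B by virtue of finitely many members of [E]. For an [x] solving all of
     these, the map sending w to [w.1 + lin_ext x w.2] carries lifts of the solution in B to a
     solution in N. *)
  apply: eqpure_pure => J2 l2 l2A [h hl].
  pose b k : P := repr (h k : quotmod W).
  have bE k : h k = quot_pi W (b k) by rewrite quot_pi_repr.
  have H e : e \in l2 -> exists ln : eqns J N * N, [/\ forall e, e \in ln.1 -> E e.1 e.2,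
      e.2 = j ln.2 & forall x, solves x ln.1 ->
      (lin_ext b e.1).1 + lin_ext x (lin_ext b e.1).2 = ln.2].
    move=> el; have [n _ en] := image_subP (l2A _ el).
    have : quot_pi W (lin_ext b e.1) = j n.
      rewrite -en -(hl _ el) lin_ext_comp; apply: eq_lin_ext => k _.
      by rewrite bE.
    move=> /jW/cert[l lE lx]; exists (l, n); split => //= x xl.
    have [F FE] := theta x; have := lx x xl; rewrite -!FE linearB => /eqP.
    by rewrite subr_eq0 => /eqP ->; rewrite FE /= linear0 addr0.
  have [ll H1 H2] := lift_list H.
  pose l : eqns J N := flatten [seq ln.1 | ln <- ll].
  have [|x xl] := finE l.
    move=> e /flatten_mapP[ln /H1[t _ [+ _ _]] eln]; exact.
  have [F FE] := theta x.
  exists (fun k => j (F (b k))) => [k|e el]; first exact: mem_image_sub.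
  have [ln lnl [_ en lnx]] := H2 e el.
  rewrite en -(lnx x) -?FE.
    by rewrite !lin_ext_comp.
  by move=> e' e'l; apply: xl; apply/flatten_mapP; exists ln.
have [r rE] := pure_ext (idfun : {linear N -> N}) pN ji jp.
have [|u uE] := @mk_linear R {malg R[J]} P (fun g => (0, g)).
  by move=> a g g'; apply: injective_projections; rewrite /= ?scaler0 ?addr0.
exists (fun k => r (quot_pi W (u << k >>))) => g a Ega.
have <- : r (quot_pi W (u g)) = lin_ext (fun k => r (quot_pi W (u << k >>))) g.
  by rewrite -[in LHS](lin_ext_id g) !lin_ext_comp.
have -> : quot_pi W (u g) = j a; last exact: rE.
apply/jW; rewrite -opprB -scaleN1r rpredZ //; apply: mem_span; exists g, a; split=> //.
by rewrite uE; apply: injective_projections; rewrite /= ?subr0 ?sub0r.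
Qed.

(** The unknowns are the values on B of the desired map, the equations express linearity and
    agreement with [f]. A finite part is solved inside A by purity, and [f] maps that solution to
    C. *)
Lemma alg_compact_ext (C A B : lmodType R) (j : {linear A -> B}) (f : {linear A -> C}) :
  alg_compact C -> injective j -> eqpure (image_sub j (full A)) ->
  exists g : {linear B -> C}, forall a, g (j a) = f a.
Proof.
move=> cC ji jp.
pose E (g : {malg R[B]}) (c : C) :=
  (exists a x y, g = << a *: x + y >> - (a *: << x >> + << y >>) /\ c = 0) \/
  (exists2 a, g = << j a >> & c = f a).
have [l lE|g gE] := cC B E.
  have Q e : e \in l -> exists e' : {malg R[B]} * A, [/\ lin_ext id e'.1 = j e'.2,
      e'.1 = e.1 & f e'.2 = e.2].
    move=> /lE; case: e => g c [[a [x [y [-> ->]]]]|[a -> ->]].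
      exists (<< a *: x + y >> - (a *: << x >> + << y >>), 0).
      by rewrite linearB linearP /= !lin_extU !linear0 subrr.
    by exists (<< j a >>, a); rewrite /= lin_extU.
  have [l' H1 H2] := lift_list Q.
  have [||h hA hl] := jp B [seq (e.1, j e.2) | e <- l'].
  - by move=> _ /mapP[e _ ->]; apply: mem_image_sub.
  - by exists id => _ /mapP[e /H1[e0 _ [He _ _]] ->]; exact: He.
  have rho0 b : exists a, h b = j a by have [a _ ->] := image_subP (hA b); exists a.
  have [rho rhoE] := choice rho0.
  exists (fun b => f (rho b)) => e el; have [e' e'l [_ e1 e2]] := H2 e el.
  rewrite -e1 -e2 -[LHS](lin_ext_comp f); congr (f _); apply: ji.
  have /= <- := hl (e'.1, j e'.2) _; last by apply/mapP; exists e'.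
  by rewrite lin_ext_comp; apply: eq_lin_ext => b _; rewrite rhoE.
have [|G GE] := @mk_linear R B C g.
  move=> a x y; apply/eqP; rewrite -subr_eq0.
  have : lin_ext g (<< a *: x + y >> - (a *: << x >> + << y >>)) = 0.
    by apply: gE; left; exists a, x, y.
  by rewrite linearB /= lin_ext_linear !lin_extU => ->.
exists G => a; rewrite GE -(gE << j a >> (f a)) ?lin_extU //.
by right; exists a.
Qed.

Lemma ideal_mul_gens (m : {pred R}) (s : seq R) (V : lmodType R) (X : submodClosed V) :
  uniq s -> (m =i span (fun x : R^o => x \in s)) ->
  forall x, x \in ideal_mul m X <->
    exists2 y : R -> V, forall q, y q \in X & x = \sum_(q <- s) q *: y q.
Proof.
move=> us ms x; split; last first.
  move=> [y yX ->]; rewrite big_seq rpred_sum // => q qs; apply: mem_span.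
  by exists q; [rewrite ms; exact: (@mem_span R R^o (fun x => x \in s)) | exists (y q)].
move: x; apply: span_ind.
- by exists (fun=> 0) => [q|]; rewrite ?rpred0 // big1 // => q _; rewrite scaler0.
- move=> a u v [y yX ->] [z zX ->]; exists (fun q => a *: y q + z q).
    by move=> q; rewrite rpredD ?rpredZ.
  rewrite scaler_sumr -big_split; apply: eq_bigr => q _ /=.
  by rewrite scalerDr !scalerA mulrC.
- move=> _ [r + [a aX ->]]; rewrite ms; move: r.
  apply: (@span_ind R R^o _ (fun r : R => exists2 y : R -> V, forall q, y q \in X &
    r *: a = \sum_(q <- s) q *: y q)).
  + exists (fun=> 0) => [q|]; rewrite ?rpred0 // big1 ?scale0r // => q _.
    by rewrite scaler0.
  + move=> b u v [y yX yE] [z zX zE]; exists (fun q => b *: y q + z q).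
      by move=> q; rewrite rpredD ?rpredZ.
    rewrite scalerDl -scalerA yE zE scaler_sumr -big_split; apply: eq_bigr => q _ /=.
    by rewrite scalerDr !scalerA mulrC.
  + move=> q qs; exists (fun q' => if q' == q then a else 0).
      by move=> q'; case: ifP => // _; exact: rpred0.
    rewrite (bigD1_seq q) //= eqxx big1 ?addr0 // => q' /negPf ->.
    by rewrite scaler0.
Qed.

(** An unknown in mN is a combination of the generators of m with unknown coefficients in N, so a
    system over mN becomes one over N. *)
Lemma ideal_mul_alg_compact (m : {pred R}) (s : seq R) (N : lmodType R) :
  uniq s -> (m =i span (fun x : R^o => x \in s)) ->
  alg_compact N -> alg_compact (submod (ideal_mul m (full N))).
Proof.
move=> us ms cN J E finE; pose C : lmodType R := submod (ideal_mul m (full N)).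
pose tr (g : {malg R[J]}) : {malg R[(J * R)%type]} :=
  lin_ext (fun j => \sum_(q <- s) q *: << (j, q) >>) g.
have trE (x : J * R -> N) g :
    lin_ext x (tr g) = lin_ext (fun j => \sum_(q <- s) q *: x (j, q)) g.
  rewrite lin_ext_sub; apply: eq_lin_ext => j _; rewrite linear_sum.
  by apply: eq_bigr => q _; rewrite linearZ /= lin_extU.
have [l lE|x xE] := cN (J * R)%type
    (fun g a => exists (g' : {malg R[J]}) (a' : C), [/\ E g' a', g = tr g' & a = val a']).
  have [|l' H1 H2] := @lift_list ({malg R[J]} * C)%type ({malg R[J * R]} * N)%type
      (fun e' e => [/\ E e'.1 e'.2, e.1 = tr e'.1 & e.2 = val e'.2]) l.
    by move=> e /lE[g [a H]]; exists (g, a).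
  have [|h hl] := finE l'; first by move=> e /H1[t _ []].
  have h0 j : exists y : R -> N, val (h j) = \sum_(q <- s) q *: y q.
    by have [y _ ->] := (ideal_mul_gens _ us ms _).1 (valP (h j)); exists y.
  have [y yE] := choice h0.
  exists (fun jq => y jq.1 jq.2) => e el; have [e' e'l [_ e1 e2]] := H2 e el.
  rewrite e1 trE e2 -(hl _ e'l) [RHS](lin_ext_comp (incl _)).
  by apply: eq_lin_ext => j _ /=; rewrite -yE.
have mem j : \sum_(q <- s) q *: x (j, q) \in ideal_mul m (full N).
  by apply/(ideal_mul_gens _ us ms); exists (fun q => x (j, q)).
exists (fun j => exist (fun z => z \in ideal_mul m (full N)) _ (mem j) : C) => g a Ega.
apply: val_inj; rewrite [LHS](lin_ext_comp (incl _)).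
have <- : lin_ext x (tr g) = val a by apply: xE; exists g, a.
by rewrite trE.
Qed.

(** The equational criterion of flatness. The free module on [J] modulo the finitely supported
    solutions in R embeds in R^k. The sum of the tensors of the unknowns with their values [h] dies
    in R^k tensor L, hence is zero by flatness; this says that [h] on [d] is a combination of
    solutions in R. *)
Lemma flat_equations (L : lmodType R) (J : choiceType) (gs : seq {malg R[J]})
    (h : J -> L) (d : {fset J}) : flat L ->
  (forall g, g \in gs -> lin_ext h g = 0) ->
  (forall g, g \in gs -> fsubset (msupp g) d) ->
  exists2 l : seq ({malg R[J]} * L)%type,
    (forall e g, e \in l -> g \in gs -> lin_ext (fun j => e.1@_j : R^o) g = 0) &
    forall j, j \in d -> h j = \sum_(e <- l) e.1@_j *: e.2.
Proof.
move=> fL hgs gsd; pose k := size gs.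
pose g (i : 'I_k) : {malg R[J]} := tnth (in_tuple gs) i.
have gP i : g i \in gs by exact: mem_tnth.
pose V : lmodType R := prodmod (fun _ : 'I_k => R^o).
have pairP (u v : {malg R[J]}) a (f : {malg R[J]}) :
    lin_ext (fun j => (a *: u + v)@_j : R^o) f =
    a * lin_ext (fun j => u@_j : R^o) f + lin_ext (fun j => v@_j : R^o) f.
  apply: etrans (lin_ext_combine a (fun j => u@_j : R^o) (fun j => v@_j : R^o) f).
  by apply: eq_lin_ext => j _; rewrite mcoeffD mcoeffZ.
have pairU j (f : {malg R[J]}) : lin_ext (fun j' => << j >>@_j' : R^o) f = f@_j.
  apply: etrans (etrans (lin_ext_single j (1 : R^o) f) (mulr1 _)).
  apply: eq_lin_ext => j' _.
  by rewrite /= mcoeffU eq_sym; case: (_ == _).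
have [|q qE] := @mk_linear R {malg R[J]} V (fun u i => lin_ext (fun j => u@_j : R^o) (g i)).
  by move=> a u v; apply: functional_extensionality_dep => i; exact: pairP.
pose A : lmodType R := quotmod (ker_sub q).
have [x|f fE] := @quot_lift R _ _ (ker_sub q) q; first by rewrite mem_ker => /eqP.
have fi : injective (f : A -> V).
  move=> a a' e; apply/eqP; rewrite -subr_eq0; apply/eqP.
  have : f (a - a') = 0 by rewrite linearB e subrr.
  have [v ->] := quot_pi_surj (a - a').
  by rewrite fE => qv; apply/quot_pi0; rewrite mem_ker qv.
pose w : tensor A L := \sum_(j <- d) tens (quot_pi (ker_sub q) << j >> : A) (h j).
have w0 : w = 0.
  apply: (fL _ _ _ fi); rewrite linear0 linear_sum.
  transitivity (\sum_(j <- d) \sum_i (g i)@_j *: tens (unit_vec i) (h j)).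
    apply: eq_bigr => j _; rewrite [LHS]tensor_map_tens fE.
    rewrite [q << j >>]unit_vec_sum tens_suml; apply: eq_bigr => i _.
    by rewrite tensZl qE pairU.
  rewrite exchange_big big1 //= => i _.
  transitivity (tens (unit_vec i) (lin_ext h (g i))); last by rewrite hgs // tens0r.
  rewrite (lin_ext_wider _ (gsd _ (gP i))) tens_sumr.
  by apply: eq_bigr => j _; rewrite tensZr.
pose W : lmodType R := prodmod (fun _ : J => L).
pose solves_all (l : seq ({malg R[J]} * L)%type) := forall e f, e \in l -> f \in gs ->
  lin_ext (fun j => e.1@_j : R^o) f = 0.
have [||T TP] := @mk_sub R W
    (fun v => exists2 l, solves_all l & forall j, v j = \sum_(e <- l) e.1@_j *: e.2).
- by exists [::] => // j; rewrite big_nil.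
- move=> a u v [l1 g1 E1] [l2 g2 E2].
  exists ([seq (e.1, a *: e.2) | e <- l1] ++ l2).
    by move=> e f'; rewrite mem_cat => /orP[/mapP[e' /g1 H ->]|/g2]; [exact: H | exact].
  move=> j; rewrite prodE prodZE E1 E2 big_cat big_map /= scaler_sumr; congr (_ + _).
  by apply: eq_bigr => e _; rewrite !scalerA mulrC.
pose bb (u : {malg R[J]}) (y : L) : W := fun j => u@_j *: y.
have bbP a u v y : bb (a *: u + v) y = a *: bb u y + bb v y.
  apply: functional_extensionality_dep => j; rewrite prodE prodZE /bb.
  by rewrite mcoeffD mcoeffZ scalerDl scalerA.
have bbB u v y : bb u y - bb v y = bb (u - v) y.
  apply: functional_extensionality_dep => j; rewrite /bb mcoeffB scalerBl.
  by [].
pose b (u : A) (y : L) : quotmod T := quot_pi T (bb (repr (u : quotmod (ker_sub q))) y).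
have bE u y : b (quot_pi _ u) y = quot_pi T (bb u y).
  apply/quot_piP; rewrite bbB.
  have : repr (quot_pi (ker_sub q) u) - u \in ker_sub q.
    by apply/quot_piP; rewrite quot_pi_repr.
  rewrite mem_ker => /eqP; move: (repr _ - u) => v qv; apply/TP.
  exists [:: (v, y)] => [e f'|j]; last by rewrite big_seq1.
  rewrite inE => /eqP -> /= /(tnthP (in_tuple gs))[i ->].
  by have := congr1 (fun F : V => F i) qv; rewrite qE.
have [||F FE] := @tens_lift R A L (quotmod T) b.
- move=> u a y y'; have [v ->] := quot_pi_surj u; rewrite !bE -linearP.
  congr (quot_pi _ _); apply: functional_extensionality_dep => j.
  by rewrite prodE prodZE /bb scalerDr !scalerA mulrC.
- move=> y a u u'; have [v ->] := quot_pi_surj u; have [v' ->] := quot_pi_surj u'.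
  by rewrite -linearP !bE bbP linearP.
have : F w = 0 by rewrite w0 linear0.
rewrite linear_sum.
have -> : \sum_(j <- d) F (tens (quot_pi (ker_sub q) << j >> : A) (h j)) =
    quot_pi T (fun j => if j \in d then h j else 0).
  transitivity (quot_pi T (\sum_(j <- d) bb << j >> (h j))).
    by rewrite linear_sum; apply: eq_bigr => j _; rewrite FE bE.
  congr (quot_pi _ _); apply: functional_extensionality_dep => j; rewrite prod_sumE.
  case: ifP => jd.
    rewrite (big_fsetD1 j) //= big1_fset ?addr0 => [|j']; first by rewrite /bb mcoeffUU scale1r.
    by rewrite !inE /bb mcoeffU => /andP[/negPf -> _] _; rewrite scale0r.
  rewrite big1_fset // => j' j'd _; rewrite /bb mcoeffU.
  by case: eqP j'd jd => [-> ->|] //; rewrite scale0r.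
move=> /quot_pi0/TP[l gl lE]; exists l => // j jd.
by rewrite -lE jd.
Qed.

End Equations.

(** * Endomorphisms of a pure-injective hull *)

Lemma dep_choice (I : Type) (T : I -> Type) (P : forall i, T i -> Prop) :
  (forall i, exists x, P i x) -> exists f : forall i, T i, forall i, P i (f i).
Proof. by move=> H; exists (fun i => projT1 (cid (H i))) => i; exact: projT2 (cid _). Qed.

Section Endomorphisms.
Context {R : comNzRingType} {N : lmodType R}.

Definition join_fun (J : Type) (f : N -> N) (x : J -> N) (k : N + J) : N :=
  match k with inl n => f n | inr j => x j end.

(** These sets of maps are the closed sets of the compactness argument: projections of solution
    sets, the values of [f] and the auxiliary [x] being unknowns together. *)
Definition pp_closed (T : (N -> N) -> Prop) : Prop :=
  exists (J : choiceType) (E : {malg R[(N + J)%type]} -> N -> Prop),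
    forall f, T f <-> exists x : J -> N,
      forall g a, E g a -> lin_ext (join_fun f x) g = a.

(** The values of [t] become auxiliary unknowns; this is what the projection in [pp_closed] is
    for. *)
Lemma pp_closed_comp T (e : N -> N) : pp_closed T ->
  pp_closed (fun f => exists2 t, T t & f =1 t \o e).
Proof.
move=> [J [E TE]].
pose tr (g : {malg R[(N + J)%type]}) : {malg R[(N + (N + J))%type]} :=
  lin_ext (fun k => << inr k >>) g.
pose eqf (n : N) : {malg R[(N + (N + J))%type]} := << inl n >> - << inr (inl (e n)) >>.
have trE f (x : N + J -> N) g : lin_ext (join_fun f x) (tr g) = lin_ext x g.
  by rewrite lin_ext_sub; apply: eq_lin_ext => k _; rewrite lin_extU.
have eqfE f (x : N + J -> N) n :
    lin_ext (join_fun f x) (eqf n) = f n - x (inl (e n)).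
  by rewrite linearB /= !lin_extU.
exists (N + J)%type, (fun g a => (exists2 n, g = eqf n & a = 0) \/
  (exists2 g', E g' a & g = tr g')) => f; split.
  move=> [t /TE[x xE] ft]; exists (join_fun t x) => g a.
  case=> [[n -> ->]|[g' Ega ->]]; last by rewrite trE; exact: xE.
  by rewrite eqfE ft subrr.
move=> [x xE]; exists (x \o inl).
  apply/TE; exists (x \o inr) => g a Ega.
  rewrite -(xE (tr g) a); last by right; exists g.
  by rewrite trE; apply: eq_lin_ext => -[].
move=> n; apply/eqP; rewrite -subr_eq0 -eqfE; apply/eqP.
by apply: xE; left; exists n.
Qed.

Lemma pp_closed_fix T (e : N -> N) : pp_closed T ->
  pp_closed (fun f => T f /\ f \o e =1 e).
Proof.
move=> [J [E TE]]; exists J, (fun g a => E g a \/ exists2 n, g = << inl (e n) >> & a = e n).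
move=> f; split.
  move=> [/TE[x xE] fe]; exists x => g a [/xE //|[n -> ->]].
  by rewrite lin_extU; exact: fe.
move=> [x xE]; split; first by apply/TE; exists x => g a Ega; apply: xE; left.
move=> n; have := xE << inl (e n) >> (e n); rewrite lin_extU /=; apply.
by right; exists n.
Qed.

(** The systems are united with their auxiliary unknowns kept disjoint; algebraic compactness of N,
    applied to this union, is the finite intersection property. *)
Lemma pp_closed_inter (I : choiceType) (T : I -> (N -> N) -> Prop) :
  alg_compact N -> (forall i, pp_closed (T i)) ->
  pp_closed (fun f => forall i, T i f) /\
  ((forall l : seq I, exists f, forall i, i \in l -> T i f) -> exists f, forall i, T i f).
Proof.
move=> cN cl; pose J i := projT1 (cid (cl i)); pose clJ i := projT2 (cid (cl i)).
pose E i := projT1 (cid (clJ i)).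
have TE i : forall f, T i f <-> exists x : J i -> N,
    forall g a, E i g a -> lin_ext (join_fun f x) g = a by exact: projT2 (cid (clJ i)).
pose K : choiceType := {i : I & J i}.
pose up i (k : N + J i) : N + K :=
  match k with inl n => inl n | inr j => inr (Tagged J j) end.
pose tr i (g : {malg R[(N + J i)%type]}) : {malg R[(N + K)%type]} :=
  lin_ext (fun k => << up i k >>) g.
have trE i f (x : K -> N) g :
    lin_ext (join_fun f x) (tr i g) = lin_ext (join_fun f (fun j => x (Tagged J j))) g.
  rewrite lin_ext_sub; apply: eq_lin_ext => k _; rewrite lin_extU.
  by case: k.
pose EE g a := exists i g', E i g' a /\ g = tr i g'.
have EEP f : (forall i, T i f) <->
    exists x : K -> N, forall g a, EE g a -> lin_ext (join_fun f x) g = a.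
  split=> [Tf|[x xE] i]; last first.
    apply/TE; exists (fun j => x (Tagged J j)) => g a Ega.
    by rewrite -trE; apply: xE; exists i, g.
  have /dep_choice[x xE] : forall i, exists x : J i -> N, forall g a, E i g a ->
     lin_ext (join_fun f x) g = a by move=> i; apply/TE.
  exists (fun k => x (tag k) (tagged k)) => g a [i [g' [Ega ->]]].
  by rewrite trE -(xE i _ _ Ega).
split; first by exists K, EE.
move=> fin; have [l lE|h hE] := cN (N + K)%type EE; last first.
  exists (h \o inl); apply/EEP; exists (h \o inr) => g a Ega.
  by rewrite -(hE _ _ Ega); apply: eq_lin_ext => -[].
have [|s _ sl] := @lift_list I _ (fun i e => exists g' a, E i g' a /\ e = (tr i g', a)) l.
  by move=> [g a] /lE[i [g' [Ega /= ->]]]; exists i, g', a.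
have [f fs] := fin s.
have /dep_choice[x xE] : forall i, exists x : J i -> N, i \in s -> forall g a, E i g a ->
    lin_ext (join_fun f x) g = a.
  move=> i; case: (boolP (i \in s)) => [/fs/TE[x xE]|_]; last by exists (fun=> 0).
  by exists x.
exists (join_fun f (fun k : K => x (tag k) (tagged k))) => e /sl[i si [g' [a [Ega ->]]]].
by rewrite trE -(xE i si _ _ Ega).
Qed.

Hypotheses (cN : alg_compact N).

Let sub_semigroup (T : (N -> N) -> Prop) :=
  [/\ pp_closed T, exists f, T f & forall f g, T f -> T g -> T (f \o g)].

(* The Ellis-Numakura lemma, algebraic compactness of N playing the role of   *)
(* the topological compactness of the semigroup.                              *)
Lemma idempotent_in_semigroup T0 : sub_semigroup T0 ->
  exists2 f, T0 f & f \o f =1 f.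
Proof.
move=> T0s.
(* [C] is the part removed from [T0]: a maximal [C] from Zorn's lemma leaves a minimal closed
   subsemigroup. *)
pose P (C : classical_sets.set (N -> N)) := sub_semigroup (fun f => T0 f /\ ~ C f).
have [F FP Ftot|A [PA Amax]] := @classical_sets.Zorn_bigcup (N -> N) P.
  pose I := option {classic {C | F C}}.
  pose T (o : I) f := match o with None => T0 f | Some c => T0 f /\ ~ sval c f end.
  have Ts o : sub_semigroup (T o) by case: o => [[C FC]|] //; exact: FP.
  have [Tcl Tne] := pp_closed_inter cN (fun o => let: And3 h _ _ := Ts o in h).
  have TT f : (forall o, T o f) <-> (T0 f /\ ~ classical_sets.bigcup F id f).
    split=> [Tf|[T0f nF] [[C FC]|] //].
      split; first exact: (Tf None).
      by move=> [C FC Cf]; have [_] := Tf (Some (exist _ C FC)); apply.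
    by split => // Cf; apply: nF; exists C.
  have PTT : (fun f => T0 f /\ ~ classical_sets.bigcup F id f) = (fun f => forall o, T o f).
    by apply: funext => f; apply/propext; split => /TT.
  rewrite /P PTT; split => //; last first.
    by move=> f g Tf Tg o; have [_ _ H] := Ts o; apply: H.
  apply: Tne => l.
  suff [o oP] : exists o, forall o', o' \in l -> forall f, T o f -> T o' f.
    by have [_ [f fo] _] := Ts o; exists f => o' /oP; apply.
  elim: l => [|o l [o1 IH]]; first by exists None.
  have tot (p p' : I) : (forall f, T p f -> T p' f) \/ (forall f, T p' f -> T p f).
    case: p p' => [[C FC]|] [[D FD]|] /=.
    - have [CD|DC] := Ftot _ _ FC FD.
        by right => f [? nD]; split => // /CD.
      by left => f [? nD]; split => // /DC.
    - by left=> f [].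
    - by right=> f [].
    - by left.
  have [H|H] := tot o o1.
    exists o => o'; rewrite inE => /orP[/eqP -> //|/IH H'] f /H; exact: H'.
  by exists o1 => o'; rewrite inE => /orP[/eqP -> //|/IH].
pose T f := T0 f /\ ~ A f.
have Tmin T' : sub_semigroup T' -> (forall f, T' f -> T f) -> forall f, T f -> T' f.
  move=> sT' T'T f Tf; apply: contrapT => nT'f.
  have := Amax (fun f => ~ T' f); apply; last first.
    rewrite /P; have -> // : (fun f => T0 f /\ ~ ~ T' f) = T'.
    apply: funext => g; apply/propext; split => [[_ /contrapT]|T'g] //.
    by split; [have [] := T'T _ T'g | apply].
  split; first by move=> g Ag T'g; have [_] := T'T _ T'g; apply.
  by move=> /(_ f nT'f); case: Tf.
(* For x in the minimal T, the left ideal T x is a closed subsemigroup of T, hence equals T, and x =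
   t x for some t in T. So the f in T with f x = x form a nonempty closed subsemigroup, again all of
   T, and x x = x. *)
have [Tcl [x Tx] Tcomp] := PA.
have [t Tt xt] : exists2 t, T t & x =1 t \o x.
  apply: (Tmin (fun f => exists2 t, T t & f =1 t \o x)) => //.
    split; first exact: pp_closed_comp.
      by exists (x \o x), x.
    move=> f g [t Tt ft] [t' Tt' gt']; exists (t \o (x \o t')).
      by apply: (Tcomp) => //; apply: (Tcomp).
    by move=> n /=; rewrite ft /= gt'.
  move=> f [t Tt /funext ->]; exact: Tcomp.
exists x; first by case: Tx.
have [] := Tmin (fun f => T f /\ f \o x =1 x) _ _ x Tx => //; last by move=> f [].
split; first exact: pp_closed_fix.
  by exists t; split => // n; rewrite xt.
move=> f g [Tf fx] [Tg gx]; split; first exact: Tcomp.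
by move=> n /=; rewrite [g (x n)]gx [LHS]fx.
Qed.

End Endomorphisms.

Section HullEndomorphisms.
Context {R : comNzRingType} {M N : lmodType R} (i : {linear M -> N}).

Definition endo_over (f : N -> N) : Prop := linear f /\ forall x, f (i x) = i x.

Lemma pp_closed_endo : pp_closed endo_over.
Proof.
pose u (n : N) : {malg R[(N + void)%type]} := << inl n >>.
exists void, (fun g a =>
  (exists r x y, g = u (r *: x + y) - (r *: u x + u y) /\ a = 0) \/
  (exists x, g = u (i x) /\ a = i x)) => f; split.
  move=> [fl fi]; exists (of_void N) => g a.
  case=> [[r [x [y [-> ->]]]]|[x [-> ->]]]; last by rewrite lin_extU /= fi.
  by rewrite linearB /= lin_ext_linear !lin_extU /= fl subrr.
move=> [x xE]; split; last first.
  move=> y; have := xE (u (i y)) (i y); rewrite lin_extU; apply.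
  by right; exists y.
move=> r y z; apply/eqP; rewrite -subr_eq0; apply/eqP.
rewrite -[RHS](xE (u (r *: y + z) - (r *: u y + u z)) 0).
  by rewrite linearB /= lin_ext_linear !lin_extU.
by left; exists r, y, z.
Qed.

(** An idempotent over M is the identity: its kernel X meets M in 0 and (X + M)/X is pure in N/X, so
    X = 0 by pure-essentiality. The left ideal of the maps c e contains an idempotent, whence c e =
    1 for some c over M; then e c is idempotent as well, and e c = 1. *)
Lemma hull_endo_surj : pure_injective_hull i -> forall e : {linear N -> N},
  (forall x, e (i x) = i x) -> forall n, exists n', e n' = n.
Proof.
move=> [ii [ip iess] /pinj_alg_compact cN].
have ker0 (f : {linear N -> N}) : (forall x, f (i x) = i x) -> (f \o f =1 f) -> f =1 id.
  move=> fi ff.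
  have k0 : forall x, x \in ker_sub f -> x = 0.
    apply: iess.
      move=> x; rewrite mem_ker => /eqP fx /image_subP[y _ xE].
      by rewrite xE -fi -xE.
    (* As [f] kills X, applying it to lifts of a solution in N/X solves the system in N with
       right-hand sides in M. Purity moves this solution into M, from where it is projected to
       N/X. *)
    apply: eqpure_pure => J l lA [h hl].
    have H e : e \in l -> exists e' : {malg R[J]} * N, [/\ e'.2 \in image_sub i (full M),
        e'.1 = e.1, e.2 = quot_pi (ker_sub f) e'.2 &
        lin_ext (f \o (repr \o h)) e.1 = e'.2].
      move=> el; have [z /sum_subP[x [a [xk aA ->]]] eE] := image_subP (lA e el).
      have fa : f a = a by have [y _ ->] := image_subP aA.
      have fx : f x = 0 by move: xk; rewrite mem_ker => /eqP.
      exists (e.1, a); split => //=.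
        have qx : quot_pi (ker_sub f) x = 0 by apply/quot_pi0.
        by rewrite eE -[RHS]add0r -qx; exact: linearD.
      have : quot_pi (ker_sub f) (lin_ext (repr \o h) e.1) = quot_pi _ (x + a).
        rewrite -eE -(hl _ el) lin_ext_comp; apply: eq_lin_ext => k _ /=.
        by rewrite quot_pi_repr.
      move=> /quot_piP; rewrite mem_ker linearB linearD fx fa add0r subr_eq0 => /eqP <-.
      by rewrite lin_ext_comp.
    have [l' H1 H2] := lift_list H.
    have [||h' h'A h'l] := pure_eqpure ip (l := l').
    - by move=> e /H1[? _ []].
    - exists (f \o (repr \o h)) => e /H1[e0 _ [_ -> _ ->]] //.
    exists (fun j => quot_pi _ (h' j)) => [j|e /H2[e' e'l [_ e1 -> _]]].
      rewrite -[h' j]add0r; apply: mem_image_sub; apply: mem_sum_sub => //.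
      exact: rpred0.
    by rewrite -(h'l _ e'l) e1 lin_ext_comp.
  move=> n; apply/eqP; rewrite -subr_eq0; apply/eqP/k0.
  by rewrite mem_ker linearB -[f (f n)]/((f \o f) n) ff subrr.
move=> e ei; have clS := pp_closed_endo.
have Scomp f g : endo_over f -> endo_over g -> endo_over (f \o g).
  move=> [fl fi] [gl gi]; split; last by move=> x; rewrite /= gi.
  by move=> a x y; rewrite /= gl fl.
have Se : endo_over e by split => //; exact: linearP.
have [|f [c Sc fE] ff] := @idempotent_in_semigroup R N cN
    (fun f => exists2 c, endo_over c & f =1 c \o e).
  split; first exact: pp_closed_comp.
    by exists e, id => //; split.
  move=> f g [c Sc fE] [c' Sc' gE]; exists (c \o (e \o c')).
    by apply: (Scomp) => //; apply: (Scomp).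
  by move=> n; rewrite /= fE /= gE.
have idem g : endo_over g -> g \o g =1 g -> g =1 id.
  move=> [gl gi] gg; have [G GE] := mk_linear gl.
  move=> n; rewrite -GE; apply: ker0 => [x|x]; rewrite /= ?GE //.
  exact: gg.
have ce : c \o e =1 id.
  have cef : c \o e = f by apply: funext => n; rewrite fE.
  by apply: idem; [exact: Scomp | rewrite cef].
have ec : e \o c =1 id.
  apply: idem; first exact: Scomp.
  by move=> n /=; rewrite -[c (e _)]/((c \o e) _) ce.
by move=> n; exists (c n); exact: ec.
Qed.
End HullEndomorphisms.

(** * Noetherian modules and local rings *)

Section NoetherianModules.
Context {R : comNzRingType}.

Definition noetherian_module (V : lmodType R) : Prop :=
  forall X : submodClosed V, finitely_generated X.

Lemma noeth_max (V : lmodType R) (F : submodClosed V -> Prop) :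
  noetherian_module V -> (exists X, F X) ->
  exists2 X, F X & forall Y, F Y -> {subset X <= Y} -> {subset Y <= X}.
Proof.
move=> nV [X0 FX0]; apply: contrapT => H.
have nxt0 (X : {X | F X}) : exists Y : {X | F X},
    {subset sval X <= sval Y} /\ exists2 y, y \in sval Y & y \notin sval X.
  apply: contrapT => nY; apply: H; exists (sval X); first exact: (svalP X).
  move=> Y FY XY y Yy; apply: contrapT => /negP Xy.
  by apply: nY; exists (exist _ Y FY); split => //; exists y.
have [nxt nxtP] := choice nxt0.
pose s n := sval (iter n nxt (exist _ X0 FX0)).
have s_mono n k x : x \in s n -> x \in s (n + k)%N.
  elim: k => [|k IH]; rewrite ?addn0 // addnS => /IH; exact: (nxtP _).1.
have [||U UP] := @mk_sub R V (fun x => exists n, x \in s n).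
- by exists 0%N; exact: rpred0.
- move=> a u v [n un] [k vk]; exists (n + k)%N.
  rewrite rpredD ?rpredZ //; first exact: s_mono.
  by rewrite addnC s_mono.
have [g gU] := nV U.
have [n sn] : exists n, forall x, x \in g -> x \in s n.
  have : forall x, x \in g -> exists n, x \in s n.
    by move=> x xg; apply/UP; rewrite gU; exact: mem_span.
  elim: g {gU} => [|x g IH] gs; first by exists 0%N.
  have [n sn] : exists n, forall x, x \in g -> x \in s n.
    by apply: IH => y yg; apply: gs; rewrite inE yg orbT.
  have [k xk] := gs x (mem_head _ _).
  exists (n + k)%N => y; rewrite inE => /orP[/eqP ->|/sn]; last exact: s_mono.
  by rewrite addnC s_mono.
have [y ys /negP []] := (nxtP (iter n nxt (exist _ X0 FX0))).2.
apply: (span_min sn); rewrite -gU; apply/UP.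
by exists n.+1.
Qed.

Lemma fg_ext (V : lmodType R) (X : submodClosed V) (p : {linear V -> R^o})
    (X' : submodClosed V) : (forall x, x \in X' <-> x \in X /\ p x = 0) ->
  finitely_generated (image_sub p X) -> finitely_generated X' -> finitely_generated X.
Proof.
move=> X'P [s sP] [t tP].
have lift0 (r : R^o) : exists x, r \in s -> x \in X /\ p x = r.
  case: (boolP (r \in s)) => [rs|_]; last by exists 0.
  have : r \in image_sub p X by rewrite sP; exact: mem_span.
  by move=> /image_subP[x xX ->]; exists x.
have [lift liftP] := choice lift0.
exists (map lift s ++ t) => x; apply/idP/idP; last first.
  apply: span_min => {}x; rewrite mem_cat => /orP[/mapP[r rs ->]|xt].
    by have [] := liftP r rs.
  have : x \in X' by rewrite tP; exact: mem_span.
  by move=> /X'P[].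
move=> xX; have : p x \in span (fun r => r \in s) by rewrite -sP mem_image_sub.
have key r : r \in span (fun r => r \in s) ->
    exists2 z, z \in X & z \in span (fun z => z \in map lift s ++ t) /\ p z = r.
  move: r; apply: span_ind.
  - by exists 0; rewrite ?rpred0 ?linear0.
  - move=> a u v [z zX [zs zE]] [w wX [ws wE]]; exists (a *: z + w).
      by rewrite rpredD ?rpredZ.
    by rewrite rpredD ?rpredZ // linearP zE wE.
  - move=> r rs; have [lX lE] := liftP r rs; exists (lift r) => //; split => //.
    by apply: mem_span; rewrite mem_cat map_f.
move=> /key[z zX [zs zE]]; rewrite -(subrK z x) rpredD //.
have : x - z \in X' by apply/X'P; rewrite rpredBs // linearB zE subrr.
rewrite tP; apply: span_min => y yt; apply: mem_span.
by rewrite mem_cat yt orbT.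
Qed.

(** Induction on a list of coordinates that detect zero in the submodule: on the kernel of the first
    coordinate the remaining ones suffice. *)
Lemma noetherian_power k : noetherian R ->
  noetherian_module (prodmod (fun _ : 'I_k => R^o)).
Proof.
move=> nR X; pose V : lmodType R := prodmod (fun _ : 'I_k => R^o).
suff H (ds : seq 'I_k) (Y : submodClosed V) :
    (forall x, x \in Y -> (forall i, i \in ds -> x i = 0) -> x = 0) -> finitely_generated Y.
  apply: (H (enum 'I_k)) => x _ x0; apply: functional_extensionality_dep => i.
  by apply: x0; rewrite mem_enum.
elim: ds Y => [|i ds IH] Y Y0.
  exists [::] => x; apply/idP/idP => [xY|].
    by rewrite (Y0 x) ?rpred0.
  by apply: span_min.
have [//|p pE] := @mk_linear R V R^o (fun v => v i).
have [||Y' Y'P] := @mk_sub R V (fun x => x \in Y /\ p x = 0).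
- by rewrite rpred0 linear0.
- move=> a u v [uY pu] [vY pv]; rewrite rpredD ?rpredZ // linearP pu pv.
  by rewrite scaler0 addr0.
apply: (fg_ext Y'P); first exact: nR.
apply: IH => x /Y'P[xY px] x0; apply: Y0 => // j.
by rewrite inE => /orP[/eqP ->|/x0 //]; rewrite -pE.
Qed.

End NoetherianModules.

Section LocalRing.
Context {R : comNzRingType} {m : {pred R}}.
Hypotheses (noethR : noetherian R) (localR : local_ring m).

(** Otherwise the ideal generated by [a] lies in a proper ideal maximal among those containing it;
    that is a maximal ideal, hence m. *)
Lemma local_unit a : a \notin m -> exists b, b * a = 1.
Proof.
move=> am; apply: contrapT => nu.
have [||I IP] := @mk_sub R R^o (fun x => exists b : R, x = b * a :> R).
- by exists 0; rewrite mul0r.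
- by move=> c u v [b ->] [b' ->]; exists (c * b + b'); rewrite mulrDl -mulrA.
have [|J [IJ J1] Jmax] := @noeth_max R R^o
    (fun J => {subset I <= J} /\ (1 : R) \notin J) noethR.
  by exists I; split => //; apply/negP => /IP[b b1]; apply: nu; exists b.
have idJ (K : submodClosed R^o) : (1 : R) \notin K -> idealr_closed (K : {pred R}).
  move=> K1; split => //; first exact: rpred0.
  by move=> c u v uK vK; exact: (rpredD (rpredZ c uK) vK).
have Jm : (J : {pred R}) =i m.
  apply: localR.2; split; first exact: idJ.
  move=> K [K0 K1 KD] JK.
  have [||K' K'P] := @mk_sub R R^o (fun x => x \in K).
  - exact: K0.
  - by move=> c u v uK vK; exact: KD.
  move=> x; apply/idP/idP => [xK|/JK //].
  apply: (Jmax K'); last exact/K'P.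
    split; first by move=> y /IJ/JK/K'P.
    by apply/negP => /K'P; apply/negP.
  by move=> y /JK/K'P.
by move/negP: am; apply; rewrite -Jm; apply: IJ; apply/IP; exists 1; rewrite mul1r.
Qed.

Lemma maximal_ideal_sub : exists mI : submodClosed R^o, m =i mI.
Proof.
have [[[m0 m1 mD] _] _] := localR.
have [||X XP] := @mk_sub R R^o (fun x => x \in m).
- exact: m0.
- by move=> a u v um vm; exact: mD.
by exists X => x; apply/idP/idP => /XP.
Qed.

Lemma ideal_gens (I : submodClosed R^o) :
  exists2 s : seq R, uniq s & (I : {pred R}) =i span (fun x : R^o => x \in s).
Proof.
have [s sE] := noethR I.
exists (undup s) => [|x]; first exact: undup_uniq.
rewrite sE; apply/idP/idP; apply: span_min => y ys; apply: mem_span.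
  by rewrite mem_undup.
by move: ys; rewrite mem_undup.
Qed.

Lemma maximal_ideal_gens :
  exists2 s : seq R, uniq s & m =i span (fun x : R^o => x \in s).
Proof.
have [mI mE] := maximal_ideal_sub; have [s us sE] := ideal_gens mI.
by exists s => // x; rewrite mE sE.
Qed.

Lemma one_notin_m : (1 : R) \notin m.
Proof. by have [[[]]] := localR. Qed.

Lemma proper_sub_m (I : submodClosed R^o) x : (1 : R) \notin I -> x \in I -> x \in m.
Proof.
move=> I1 xI; apply: contrapT => /negP/local_unit[b bx].
by move/negP: I1; apply; rewrite -bx; exact: (rpredZ b xI).
Qed.

Lemma ideal_mulP (I : {pred R}) (V : lmodType R) (X : submodClosed V) r x :
  r \in I -> x \in X -> r *: x \in ideal_mul I X.
Proof. by move=> rI xX; apply: mem_span; exists r => //; exists x. Qed.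

Lemma ideal_mul_sub (I : {pred R}) (V : lmodType R) (X Y : submodClosed V) :
  (forall r x, r \in I -> x \in X -> r *: x \in Y) -> {subset ideal_mul I X <= Y}.
Proof. by move=> H; apply: span_min => _ [r rI [x xX ->]]; exact: H. Qed.

Lemma ideal_powX a n : a \in m -> a ^+ n \in (ideal_pow m n : {pred R}).
Proof.
move=> am; elim: n => [|n IH] //; rewrite exprS.
exact: (@ideal_mulP m R^o).
Qed.

Lemma adic0 (V : lmodType R) v : v \in adic m V 0.
Proof. by rewrite -[v]scale1r; apply: ideal_mulP. Qed.

Lemma colon_sub (V : lmodType R) (L : submodClosed V) (a : R) :
  exists K : submodClosed V, forall v, v \in K <-> a *: v \in L.
Proof.
apply: (mk_sub (P := fun v => a *: v \in L)); first by rewrite scaler0 rpred0.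
move=> b u v uL vL; rewrite scalerDr.
have -> : a *: (b *: u) = b *: (a *: u) by rewrite !scalerA mulrC.
by rewrite rpredD //; exact: rpredZ.
Qed.

(** Used to check membership of r v, for r in a product or a span, on generators r only. *)
Lemma colon_ideal (V : lmodType R) (L : submodClosed V) (v : V) :
  exists K : submodClosed R^o, forall a : R, a \in K <-> a *: v \in L.
Proof.
have [||K KP] := @mk_sub R R^o (fun a : R => a *: v \in L).
- by rewrite scale0r rpred0.
- by move=> b a c aL cL; rewrite scalerDl -scalerA rpredD //; exact: rpredZ.
by exists K => a; exact: KP.
Qed.

Lemma adicS_mul (V : lmodType R) n : {subset adic m V n.+1 <= ideal_mul m (adic m V n)}.
Proof.
apply: ideal_mul_sub => r v + _.
have [K KP] := colon_ideal (ideal_mul m (adic m V n)) v.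
move=> rn; apply/KP; apply: (ideal_mul_sub (I := m)) rn => a b am bn.
by apply/KP; rewrite -scalerA; apply: ideal_mulP => //; exact: ideal_mulP.
Qed.

Lemma ideal_mul_span (V : lmodType R) (s : seq R) (X L : submodClosed V) :
  m =i span (fun x : R^o => x \in s) ->
  (forall q v, q \in s -> v \in X -> q *: v \in L) -> {subset ideal_mul m X <= L}.
Proof.
move=> ms sL; apply: ideal_mul_sub => r v + vX; rewrite ms.
have [K KP] := colon_ideal L v.
move=> rs; apply/KP; apply: span_min rs => q qs.
by apply/KP; exact: sL.
Qed.

(** A pigeonhole argument on monomials in the generators: multiplying by q replaces L by the colon
    (L : q) and lowers the exponent of q by one. *)
Lemma adic_colon (V : lmodType R) (s : seq R) : uniq s ->
  m =i span (fun x : R^o => x \in s) ->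
  forall K (L : submodClosed V) (e : R -> nat), (\sum_(q <- s) e q <= K)%N ->
  (forall q v, q \in s -> q ^+ (e q) *: v \in L) -> {subset adic m V K.+1 <= L}.
Proof.
move=> us ms K L e eK eL x /adicS_mul; move: x; apply: (ideal_mul_span ms).
elim: K L e eK eL => [|K IH] L e eK eL q v qs vK.
  have eq0 : e q = 0%N.
    by move: eK; rewrite (bigD1_seq q) //=; case: (e q).
  by have := eL q v qs; rewrite eq0 expr0 scale1r => vL; rewrite rpredZ.
case eqE : (e q) => [|k].
  by have := eL q v qs; rewrite eqE expr0 scale1r => vL; rewrite rpredZ.
have [Lq LqP] := colon_sub L q; apply/LqP.
apply: (ideal_mul_span ms (X := adic m V K)) (adicS_mul vK) => q' w q's wK.
apply: (IH Lq (fun q' => if q' == q then k else e q')) => //.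
  move: eK; rewrite (bigD1_seq q) //= eqE addSn ltnS => eK.
  rewrite (bigD1_seq q) //= eqxx.
  by rewrite (eq_bigr e) // => j /negPf ->.
move=> p u ps; apply/LqP; case: eqP => [->|_].
  by rewrite scalerA -exprS -eqE; exact: eL.
by rewrite rpredZ // eL.
Qed.

(* Weak Artin-Rees: if L is maximal among the submodules with Y <= L and      *)
(* L meet X <= Y, then every a in m has a power with a ^+ k V <= L.           *)
Lemma adic_meet (V : lmodType R) (X Y : submodClosed V) n : noetherian_module V ->
  {subset ideal_mul (ideal_pow m n) X <= Y} ->
  exists t, forall v, v \in X -> v \in sum_sub (adic m V t) Y -> v \in Y.
Proof.
move=> nV XY.
have [|L [YL LX] Lmax] := @noeth_max R V
    (fun L => {subset Y <= L} /\ forall x, x \in L -> x \in X -> x \in Y) nV.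
  by exists Y; split.
have pw a : a \in m -> exists k, forall v, a ^+ k *: v \in L.
  move=> am.
  have col k : exists K : submodClosed V, forall v, v \in K <-> a ^+ k *: v \in L.
    exact: colon_sub.
  have [C CP] := choice col.
  have [|_ [k ->] Cmax] := @noeth_max R V (fun K => exists k, K = C k) nV.
    by exists (C 0%N), 0%N.
  have Ck v : a ^+ (n + k) *: v \in L -> a ^+ k *: v \in L.
    move=> /CP vC; apply/CP; apply: Cmax vC; first by exists (n + k)%N.
    by move=> w /CP wC; apply/CP; rewrite exprD -scalerA rpredZ.
  (* By the choice of k, (L : a^(n+k)) = (L : a^k). Hence L + a^k V still meets X inside Y: if z = l
     + a^k w is in X, then a^n z is in Y, so a^(n+k) w is in L, and so is a^k w. Maximality of L
     gives a^k V <= L. *)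
  have [||L' L'P] := @mk_sub R V (fun z => exists l v, l \in L /\ z = l + a ^+ k *: v).
  - by exists 0, 0; rewrite rpred0 scaler0 addr0.
  - move=> b _ _ [l [v [lL ->]]] [l' [v' [l'L ->]]].
    exists (b *: l + l'), (b *: v + v'); rewrite rpredD ?rpredZ //; split => //.
    by rewrite !scalerDr addrACA !scalerA [b * _]mulrC.
  exists k => v; apply: (Lmax L').
  - split=> [z zY|z].
      by apply/L'P; exists z, 0; rewrite scaler0 addr0; split => //; exact: YL.
    move=> /L'P[l [w [lL zE]]] zX; apply: LX => //; rewrite zE rpredD //.
    apply: Ck; rewrite exprD -scalerA -[a ^+ k *: w](addKr l) -zE scalerDr scalerN.
    rewrite addrC; apply: rpredBs; last exact: rpredZ.
    by apply/YL/XY; apply: ideal_mulP => //; exact: ideal_powX.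
  - by move=> z zL; apply/L'P; exists z, 0; rewrite scaler0 addr0.
  - by apply/L'P; exists 0, v; rewrite rpred0 add0r.
have [s us ms] := maximal_ideal_gens.
have /choice[e eP] : forall q, exists k, q \in s -> forall v, q ^+ k *: v \in L.
  move=> q; case: (boolP (q \in s)) => [qs|_]; last by exists 0%N.
  have [|k kP] := pw q; last by exists k.
  by rewrite ms; apply: (@mem_span R R^o (fun x => x \in s)).
have tL := @adic_colon V s us ms _ L e (leqnn _) (fun q v qs => eP q qs v).
exists (\sum_(q <- s) e q).+1 => v vX /sum_subP[x [y [/tL xL yY vE]]].
by apply: LX => //; rewrite vE rpredD // YL.
Qed.

Definition artinian_above (J : submodClosed R^o) : Prop :=
  forall F : submodClosed R^o -> Prop, (exists I, F I) ->
  (forall I, F I -> {subset J <= I}) ->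
  exists2 I, F I & forall I', F I' -> {subset I' <= I} -> {subset I <= I'}.

(** Modulo J' the ideal J' + Rx is simple or zero. Take I in F with I + Rx minimal. If a member
    inside I omits x, it is minimal, because coefficients of x outside m are units; otherwise I
    itself is minimal. *)
Lemma artinian_above_step (J J' : submodClosed R^o) (x : R^o) :
  artinian_above J -> {subset J <= sum_sub J' (span (fun y => y = x))} ->
  (forall r, r \in m -> r *: x \in J') -> artinian_above J'.
Proof.
move=> aJ JJ' mx F [I0 FI0] FJ'; pose X : submodClosed R^o := span (fun y => y = x).
have xX r : r *: x \in X by rewrite rpredZ //; exact: mem_span.
have XP z : z \in X -> exists r, z = r *: x.
  move: z; apply: span_ind; first by exists 0; rewrite scale0r.
    move=> a u v [r ->] [r' ->]; exists (a * r + r').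
    by rewrite scalerDl scalerA.
  by move=> _ ->; exists 1; rewrite scale1r.
have sumS (I I' : submodClosed R^o) : {subset I <= I'} -> {subset sum_sub I X <= sum_sub I' X}.
  by move=> II' _ /sum_subP[u [v [uI vX ->]]]; rewrite mem_sum_sub // II'.
have [||_ [I FI ->] Imin] := aJ (fun K => exists2 I, F I & K = sum_sub I X).
- by exists (sum_sub I0 X), I0.
- by move=> _ [I FI ->] z /JJ'; apply: sumS; exact: FJ'.
have Imin' I' : F I' -> {subset I' <= I} -> {subset I <= sum_sub I' X}.
  move=> FI' I'I z zI; apply: (Imin (sum_sub I' X)); first by exists I'.
    exact: sumS.
  exact: mem_sum_subl.
have [[I1 [FI1 I1I xI1]]|nI1] :=
    pselect (exists I1, [/\ F I1, {subset I1 <= I} & x \notin I1]).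
  exists I1 => // I' FI' I'I1 z zI1.
  have [||u [v [uI' /XP[r vE] zE]]] := sum_subP (Imin' I' FI' _ z _).
  - by move=> y /I'I1/I1I.
  - exact: I1I.
  rewrite zE rpredD // vE; apply: (FJ' _ FI'); apply: mx.
  apply: contrapT => /negP/local_unit[b br]; move/negP: xI1; apply.
  rewrite -[x]scale1r -br -scalerA rpredZ // -vE.
  by rewrite -(addKr u v) -zE addrC rpredBs // I'I1.
exists I => // I' FI' I'I z /(Imin' _ FI' I'I)/sum_subP[u [v [uI' /XP[r ->] ->]]].
rewrite rpredD // rpredZ //; apply: contrapT => /negP xI'.
by apply: nI1; exists I'.
Qed.

Lemma artinian_above_mono (J J' : submodClosed R^o) :
  {subset J <= J'} -> artinian_above J -> artinian_above J'.
Proof. by move=> JJ' aJ F F0 FJ'; apply: aJ => // I /FJ' J'I x /JJ'/J'I. Qed.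

(** From m^n one descends to m^(n+1) by dropping generators of m^n one at a time; m carries each of
    them into m^(n+1). *)
Lemma artinian_above_pow n : artinian_above (ideal_pow m n).
Proof.
elim: n => [|n IH].
  by move=> F [I FI] FJ; exists I => // I' /FJ I'T _ x _; exact: I'T.
have [s sE] := noethR (ideal_pow m n).
have sub0 : forall x, x \in s -> x \in (ideal_pow m n : {pred R}).
  by move=> x xs; rewrite sE; exact: mem_span.
pose J (l : seq R^o) := sum_sub (ideal_pow m n.+1) (span (fun x : R^o => x \in l)).
have {IH} : artinian_above (J s).
  apply: artinian_above_mono IH => x; rewrite sE => xs.
  exact: mem_sum_subr.
elim: s sub0 {sE} => [_|x s IH sub0].
  apply: artinian_above_mono => _ /sum_subP[u [v [uI /(span_min (X := ideal_pow m n.+1)) vI ->]]].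
  by rewrite rpredD // vI.
move=> aJ; apply: IH; first by move=> y ys; apply: sub0; rewrite inE ys orbT.
apply: (artinian_above_step (x := x) aJ).
  move=> _ /sum_subP[u [v [uI vs ->]]].
  suff : v \in sum_sub (J s) (span (fun y : R^o => y = x)).
    by move=> vJ; rewrite rpredD //; do 2!apply: mem_sum_subl.
  move: v vs; apply: span_min => y; rewrite inE => /orP[/eqP ->|ys].
    by apply: mem_sum_subr; exact: mem_span.
  by apply: mem_sum_subl; apply: mem_sum_subr; exact: mem_span.
move=> r rm; apply: mem_sum_subl.
by apply: (@ideal_mulP m R^o) => //; apply: sub0; exact: mem_head.
Qed.

End LocalRing.

(** * Flat completions *)

Lemma rpred_comb (R : comNzRingType) (V : lmodType R) (X : submodClosed V)
    (I : eqType) (u : seq I) (c : I -> R) (w : I -> V) :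
  (forall q, q \in u -> w q \in X) -> \sum_(q <- u) c q *: w q \in X.
Proof. by move=> wX; rewrite big_seq rpred_sum // => q qu; rewrite rpredZ ?wX. Qed.

(** A solution in L is a combination of solutions in R, so the value of [g'] at it is a combination
    of elements of K. Flatness of L is always applied in this form. *)
Lemma flat_functional (R : comNzRingType) (L : lmodType R) (J : choiceType)
    (gs : seq {malg R[J]}) (g' : {malg R[J]}) (h : J -> L) (K : submodClosed R^o) :
  flat L -> (forall g, g \in gs -> lin_ext h g = 0) ->
  (forall k : J -> R^o, (forall g, g \in gs -> lin_ext k g = 0) -> lin_ext k g' \in K) ->
  lin_ext h g' \in ideal_mul K (full L).
Proof.
move=> fL hgs kK; pose d := fsetU (msupp g') (\bigcup_(g <- gs) msupp g)%fset.
have [g ggs|l lgs lE] := flat_equations (d := d) fL hgs.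
  by apply: fsubset_trans (fsubsetUr _ _); exact: bigfcup_sup.
have -> : lin_ext h g' = \sum_(e <- l) lin_ext (fun j => e.1@_j : R^o) g' *: e.2.
  transitivity (\sum_(j <- msupp g') \sum_(e <- l) (g'@_j * e.1@_j) *: e.2).
    apply: eq_big_seq => j jg'; rewrite lE ?scaler_sumr; last first.
      by rewrite /d in_fsetU jg'.
    by apply: eq_bigr => e _; rewrite scalerA.
  by rewrite exchange_big; apply: eq_bigr => e _; rewrite scaler_suml.
rewrite big_seq rpred_sum // => e el; apply: ideal_mulP => //.
by apply: kK => g ggs; exact: lgs.
Qed.

Section Completion.
Context {R : comNzRingType} {m : {pred R}} {M : lmodType R}.
Local Notation L := (completion m M).

Lemma coord_ex n : exists c : {linear L -> quotmod (adic m M n)}, forall f, c f = val f n.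
Proof.
have [|c cE] := @mk_linear R L (quotmod (adic m M n)) (fun f => val f n).
  by move=> a f g.
by exists c.
Qed.

Definition adic_coord n : {linear L -> quotmod (adic m M n)} := projT1 (cid (coord_ex n)).
Lemma coordE n f : adic_coord n f = val f n.
Proof. exact: projT2 (cid (coord_ex n)) f. Qed.

Lemma mk_completion (x : forall n, quotmod (adic m M n)) :
  (forall n, adic_proj (x n.+1) = x n) -> exists f : L, forall n, adic_coord n f = x n.
Proof.
move=> xc; have xP : (x : prodmod (fun n => quotmod (adic m M n))) \in @compat_pred R m M.
  exact/asboolP.
by exists (exist (fun z => z \in @compat_pred R m M) _ xP : L) => n; rewrite coordE.
Qed.

Lemma coord_inj (f g : L) : (forall n, adic_coord n f = adic_coord n g) -> f = g.
Proof.
move=> fg; apply: val_inj; apply: functional_extensionality_dep => n.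
by have := fg n; rewrite !coordE.
Qed.

Lemma coord_proj n (f : L) : adic_proj (adic_coord n.+1 f) = adic_coord n f.
Proof. by rewrite !coordE; have /asboolP := valP f; apply. Qed.

Lemma to_completion_ex : exists F : {linear M -> L}, forall x n, adic_coord n (F x) = quot_pi _ x.
Proof.
have /choice[i iE] : forall x : M, exists f : L, forall n, adic_coord n f = quot_pi _ x.
  by move=> x; apply: mk_completion => n; exact: adic_proj_pi.
have [|F FE] := @mk_linear R M L i.
  by move=> a x y; apply: coord_inj => n; rewrite linearP !iE linearP.
by exists F => x n; rewrite FE.
Qed.

Definition to_completion : {linear M -> L} := projT1 (cid to_completion_ex).
Lemma coord_to_completion n x : adic_coord n (to_completion x) = quot_pi _ x.
Proof. exact: projT2 (cid to_completion_ex) x n. Qed.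

Lemma coord_leq n k f : adic_coord (n + k) f = 0 -> adic_coord n f = 0.
Proof.
elim: k => [|k IH]; rewrite ?addn0 // addnS => fk; apply: IH.
by rewrite -coord_proj fk linear0.
Qed.

Lemma coord_approx n f : exists x, adic_coord n (f - to_completion x) = 0.
Proof.
have [x xE] := quot_pi_surj (adic_coord n f).
by exists x; rewrite linearB coord_to_completion -xE subrr.
Qed.

Lemma completion_complete (x : nat -> L) : (forall t, adic_coord t (x t.+1 - x t) = 0) ->
  exists y, forall t, adic_coord t (y - x t) = 0.
Proof.
move=> xc; have [|y yE] := mk_completion (x := fun t => adic_coord t (x t)).
  move=> t; rewrite coord_proj; apply/eqP; rewrite -subr_eq0 -linearB xc //.
by exists y => t; rewrite linearB yE subrr.
Qed.

(** The coefficients of the successive differences tend to 0, so for each generator q they can be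
    summed in L. *)
Lemma series_mem (s : seq R) (z : L) (a : nat -> L) :
  (forall n, adic_coord n (z - a n) = 0) -> (exists b : R -> L, a 0%N = \sum_(q <- s) q *: b q) ->
  (forall n, exists2 b : R -> L, forall q, adic_coord n (b q) = 0 &
    a n.+1 - a n = \sum_(q <- s) q *: b q) ->
  exists b : R -> L, z = \sum_(q <- s) q *: b q.
Proof.
move=> za [b0 a0] aS.
have /choice[b bP] : forall n, exists b : R -> L, (forall q, adic_coord n (b q) = 0) /\
    a n.+1 - a n = \sum_(q <- s) q *: b q.
  by move=> n; have [b b1 b2] := aS n; exists b.
have b_small n q : adic_coord n (b n q) = 0 by case: (bP n).
have bE n : a n.+1 - a n = \sum_(q <- s) q *: b n q by case: (bP n).
pose B q n := b0 q + \sum_(t < n) b t q.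
have /choice[y yE] : forall q, exists y, forall n, adic_coord n (y - B q n) = 0.
  move=> q; apply: completion_complete => t.
  by rewrite /B big_ord_recr /= addrA [X in _ (X - _)]addrC addrK b_small.
have aB n : a n = \sum_(q <- s) q *: B q n.
  elim: n => [|n IH].
    by rewrite a0; apply: eq_bigr => q _; rewrite /B big_ord0 addr0.
  rewrite -(subrK (a n) (a n.+1)) bE IH addrC -big_split; apply: eq_bigr => q _ /=.
  by rewrite -scalerDr /B big_ord_recr /= addrA.
exists y; apply: coord_inj => n; apply/eqP; rewrite -subr_eq0 -linearB.
have -> : z - \sum_(q <- s) q *: y q = z - a n - \sum_(q <- s) q *: (y q - B q n).
  rewrite aB -addrA -opprD -big_split; congr (_ - _); apply: eq_bigr => q _ /=.
  by rewrite -scalerDr addrC subrK.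
rewrite linearB za linear_sum big1 ?subr0 // => q _.
by rewrite linearZ /= yE scaler0.
Qed.

Lemma adicD (V : lmodType R) n k :
  {subset adic m V (n + k) <= ideal_mul (ideal_pow m n) (adic m V k)}.
Proof.
elim: n => [|n IH] x xV.
  by rewrite -[x]scale1r; apply: ideal_mulP.
have := adicS_mul xV; apply: ideal_mul_sub => a w am /IH.
have [K KP] := colon_sub (ideal_mul (ideal_pow m n.+1) (adic m V k)) a.
move=> wV; apply/KP; apply: ideal_mul_sub wV => r v rn vk; apply/KP.
rewrite scalerA; apply: ideal_mulP => //; exact: (@ideal_mulP _ m R^o).
Qed.

Hypotheses (noethR : noetherian R).

(** The inverse limit topology is the m-adic one. If the n-th coordinate of f is zero, its
    approximations from M differ by elements of m^n (m^k M), and since m^n is finitely generated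
    [series_mem] applies. *)
Lemma coord_adic n (f : L) : adic_coord n f = 0 <-> f \in adic m L n.
Proof.
split; last first.
  move=> fn; apply/eqP; rewrite -mem_ker; move: f fn.
  apply: ideal_mul_sub => r f rn _; rewrite mem_ker linearZ /=.
  have [x ->] := quot_pi_surj (adic_coord n f).
  by rewrite -linearZ; apply/eqP/quot_pi0; apply: ideal_mulP.
move=> fn; have [s us sE] := ideal_gens noethR (ideal_pow m n).
have /choice[x xE] := fun t => coord_approx t f.
have fx k : adic_coord (n + k) (f - to_completion (x (n + k)%N)) = 0 by exact: xE.
have adx t y : adic_coord t (to_completion y) = 0 <-> y \in adic m M t.
  by rewrite coord_to_completion quot_pi0.
apply/(ideal_mul_gens _ us sE).
have [|||b bE] := @series_mem s f (fun k => to_completion (x (n + k)%N)); last by exists b.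
- by move=> k; apply: (@coord_leq k n); rewrite addnC fx.
- have : x (n + 0)%N \in adic m M n.
    apply/adx; rewrite addn0; have := xE n.
    by rewrite linearB fn sub0r => /eqP; rewrite oppr_eq0 => /eqP.
  move=> /(ideal_mul_gens _ us sE)[y _ ->]; exists (fun q => to_completion (y q)).
  by rewrite linear_sum; apply: eq_bigr => q _; rewrite linearZ.
- move=> k; have : x (n + k.+1)%N - x (n + k)%N \in adic m M (n + k).
    apply/adx; rewrite linearB.
    have := fx k; rewrite -[f in f - _](subrK (to_completion (x (n + k.+1)%N))) -addrA linearD => H.
    have := @coord_leq (n + k) 1 (f - to_completion (x (n + k.+1)%N)).
    by rewrite addn1 -addnS => /(_ (fx _)) H'; move: H; rewrite H' add0r.
  move=> /adicD/(ideal_mul_gens _ us sE)[y yk yE]; exists (fun q => to_completion (y q)).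
    by move=> q; apply/adx.
  by rewrite -linearB yE linear_sum; apply: eq_bigr => q _; rewrite linearZ.
Qed.

Lemma completion_separated (f : L) : (forall n, f \in adic m L n) -> f = 0.
Proof. by move=> H; apply: coord_inj => n; rewrite linear0; apply/coord_adic. Qed.

Hypotheses (localR : local_ring m) (flatL : flat L).

(** Flatness commutes with intersecting two ideals. The coefficients over the generators of I and of
    J are the unknowns, tied by the single equation that the two combinations agree. *)
Lemma flat_meet (I J K : submodClosed R^o) (z : L) :
  (forall r, r \in I -> r \in J -> r \in K) ->
  z \in ideal_mul I (full L) -> z \in ideal_mul J (full L) -> z \in ideal_mul K (full L).
Proof.
move=> IJK; have [s us sE] := ideal_gens noethR I; have [t ut tE] := ideal_gens noethR J.
move=> /(ideal_mul_gens _ us sE)[y _ zy] /(ideal_mul_gens _ ut tE)[y' _ zy'].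
pose g1 : {malg R[(R + R)%type]} := \sum_(q <- s) q *: << inl q >>.
pose g2 : {malg R[(R + R)%type]} := \sum_(q <- t) q *: << inr q >>.
have g1E (V : lmodType R) (h : R + R -> V) : lin_ext h g1 = \sum_(q <- s) q *: h (inl q).
  by rewrite linear_sum; apply: eq_bigr => q _; rewrite linearZ /= lin_extU.
have g2E (V : lmodType R) (h : R + R -> V) : lin_ext h g2 = \sum_(q <- t) q *: h (inr q).
  by rewrite linear_sum; apply: eq_bigr => q _; rewrite linearZ /= lin_extU.
have -> : z = lin_ext (fun k => match k with inl q => y q | inr q => y' q end) g1.
  by rewrite g1E.
apply: (flat_functional (gs := [:: g1 - g2])) => //.
  move=> g; rewrite inE => /eqP ->; rewrite linearB /= g1E g2E.
  by rewrite -zy -zy' subrr.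
move=> k /(_ _ (mem_head _ _)); rewrite linearB /= => /eqP; rewrite subr_eq0 => /eqP e12.
have sub (X : submodClosed R^o) (u : seq R) (v : R -> R^o) :
    (X : {pred R}) =i span (fun x : R^o => x \in u) -> \sum_(q <- u) q *: v q \in X.
  move=> uE; rewrite (eq_bigr (fun q => v q *: (q : R^o))); last by move=> q _; exact: mulrC.
  by apply: rpred_comb => q qu; rewrite uE; exact: (@mem_span R R^o (fun x => x \in u)).
by apply: IJK; [rewrite g1E | rewrite e12 g2E]; exact: sub.
Qed.

Lemma ideal_powD_sub n k : {subset ideal_pow m (n + k) <= ideal_pow m n}.
Proof.
elim: n => [|n IH]; first by [].
by apply: ideal_mul_sub => a r am rn; apply: ideal_mulP => //; exact: IH.
Qed.

(** Approximate z by [a n] in I L. The differences lie in I L and in m^(T n) L, hence by flatness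
    and weak Artin-Rees in m^n I L, so that [series_mem] puts the limit z in I L. *)
Lemma flat_ideal_closed (I : submodClosed R^o) (z : L) :
  (forall n, z \in sum_sub (ideal_mul I (full L)) (adic m L n)) ->
  z \in ideal_mul I (full L).
Proof.
move=> zI; have /choice[t0 t0P] : forall n, exists t, forall r : R, r \in I ->
    r \in (ideal_pow m t : {pred R}) -> r \in (ideal_mul (ideal_pow m n) I : {pred R}).
  move=> n; have [t tP] := adic_meet noethR localR noethR
    (X := I) (Y := ideal_mul (ideal_pow m n) I) (n := n) (fun x xI => xI).
  exists t => r rI rt; apply: (tP r) => //; apply: mem_sum_subl.
  by rewrite -[r]mulr1; exact: (@ideal_mulP _ _ R^o).
(* [T n] is at least [t0 n], for Artin-Rees, at least n, for convergence, and increasing, so that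
   the next approximation is also good to order [T n]. *)
pose T n := ((\sum_(k < n.+1) t0 k) + n)%N.
have T0 n : exists k, T n = (t0 n + k)%N.
  by exists ((\sum_(k < n) t0 k) + n)%N; rewrite /T big_ord_recr /= addnAC addnC.
have Tn n : exists k, T n = (n + k)%N by eexists; rewrite /T addnC.
have TS n : exists k, T n.+1 = (T n + k)%N.
  by exists (t0 n.+1).+1; rewrite /T [in LHS]big_ord_recr /= !addnS addnAC.
have TP n r : r \in I -> r \in (ideal_pow m (T n) : {pred R}) ->
    r \in (ideal_mul (ideal_pow m n) I : {pred R}).
  by move=> rI; have [k ->] := T0 n => /ideal_powD_sub; exact: t0P.
have adT n k (f : L) : f \in adic m L (n + k) -> f \in adic m L n.
  by move=> /coord_adic/coord_leq/coord_adic.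
have /choice[a aP] : forall n, exists a, a \in ideal_mul I (full L) /\ z - a \in adic m L (T n).
  move=> n; have [a [w [aI wT ->]]] := sum_subP (zI (T n)).
  by exists a; rewrite addrC addKr.
have [s us sE] := ideal_gens noethR I.
apply/(ideal_mul_gens _ us sE).
have [|||b bE] := @series_mem s z a; last by exists b.
- move=> n; apply/coord_adic; have [k Tk] := Tn n.
  by apply: (@adT n k); rewrite -Tk; exact: (aP n).2.
- by have [/(ideal_mul_gens _ us sE)[b _ bE] _] := aP 0%N; exists b.
- move=> n.
  have : a n.+1 - a n \in ideal_mul (ideal_mul (ideal_pow m n) I) (full L).
    apply: (flat_meet (I := I) (J := ideal_pow m (T n))).
    + exact: TP.
    + by rewrite rpredBs //; case: (aP n); case: (aP n.+1).
    + have -> : a n.+1 - a n = (z - a n) - (z - a n.+1).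
        by rewrite opprB [RHS]addrC addrA subrK.
      rewrite rpredBs //; first exact: (aP n).2.
      have [k Tk] := TS n.
      by apply: (@adT (T n) k); rewrite -Tk; exact: (aP n.+1).2.
  have sub : {subset ideal_mul (ideal_mul (ideal_pow m n) I) (full L) <=
      ideal_mul I (adic m L n)}.
    apply: ideal_mul_sub => r v + _.
    have [K KP] := colon_ideal (ideal_mul I (adic m L n)) v.
    move=> rn; apply/KP; apply: ideal_mul_sub rn => b c bn cI.
    apply/KP; rewrite [b *: c]mulrC -scalerA; apply: ideal_mulP => //.
    exact: ideal_mulP.
  move=> /sub/(ideal_mul_gens _ us sE)[b bn bE]; exists b => // q.
  exact/coord_adic.
Qed.

End Completion.

(** * Compactness of a flat completion and extension of maps into it *)

Lemma dependent_sequence (T : Type) (P : nat -> T -> Prop) (Q : nat -> T -> T -> Prop) :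
  (exists y, P 0%N y) -> (forall n y, P n y -> exists2 y', P n.+1 y' & Q n y y') ->
  exists2 y : nat -> T, forall n, P n (y n) & forall n, Q n (y n) (y n.+1).
Proof.
move=> [y0 P0] H.
have /choice[f fP] : forall ny : nat * T, exists y', P ny.1 ny.2 ->
    P ny.1.+1 y' /\ Q ny.1 ny.2 y'.
  move=> [n y]; case: (pselect (P n y)) => [/H[y' Py' Qy']|nP]; last by exists y.
  by exists y'.
pose y := fix y n := if n is n'.+1 then f (n', y n') else y0.
have Py n : P n (y n) by elim: n => [|n IH] //=; case: (fP (n, y n) IH).
by exists y => // n; case: (fP (n, y n) (Py n)).
Qed.

Lemma ideal_mul_sumS (R : comNzRingType) (V : lmodType R) (I I' I'' : submodClosed R^o) :
  {subset I <= sum_sub I' I''} ->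
  {subset ideal_mul I (full V) <= sum_sub (ideal_mul I' (full V)) (ideal_mul I'' (full V))}.
Proof.
move=> II; apply: ideal_mul_sub => r v /II/sum_subP[a [b [aI bI ->]]] _.
by rewrite scalerDl mem_sum_sub //; apply: ideal_mulP.
Qed.

Lemma ideal_mulS (R : comNzRingType) (V : lmodType R) (I I' : submodClosed R^o) :
  {subset I <= I'} -> {subset ideal_mul I (full V) <= ideal_mul I' (full V)}.
Proof. by move=> II; apply: ideal_mul_sub => r v /II rI' _; apply: ideal_mulP. Qed.

Section FlatCompletion.
Context {R : comNzRingType} {m : {pred R}} {M : lmodType R}.
Local Notation L := (completion m M).
Hypotheses (noethR : noetherian R) (localR : local_ring m) (flatL : flat L).

(** As R/m^n is artinian, some coset in the family has an ideal that no smaller coset shrinks modulo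
    m^n. Along a decreasing sequence of such cosets one picks points [y n] that agree modulo m^n;
    the limit lies in every coset because each I L is closed. *)
Lemma coset_inter (C : L -> submodClosed R^o -> Prop) :
  (exists c I, C c I) ->
  (forall c1 I1 c2 I2, C c1 I1 -> C c2 I2 -> exists c3 I3,
    [/\ C c3 I3, {subset I3 <= I1}, {subset I3 <= I2},
        c3 - c1 \in ideal_mul I1 (full L) & c3 - c2 \in ideal_mul I2 (full L)]) ->
  exists y, forall c I, C c I -> y - c \in ideal_mul I (full L).
Proof.
move=> [c0 [I0 C0]] dir.
pose le (p p' : L * submodClosed R^o) :=
  {subset p.2 <= p'.2} /\ p.1 - p'.1 \in ideal_mul p'.2 (full L).
have le_refl p : le p p by split => //; rewrite subrr rpred0.
have le_trans p q r : le p q -> le q r -> le p r.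
  move=> [pq pq1] [qr qr1]; split; first by move=> x /pq/qr.
  by rewrite -(subrK q.1 p.1) -addrA rpredD // (ideal_mulS qr).
pose P n (p : L * submodClosed R^o) := C p.1 p.2 /\ forall q, C q.1 q.2 -> le q p ->
  {subset p.2 <= sum_sub q.2 (ideal_pow m n)}.
have minP n p : C p.1 p.2 -> exists2 p', P n p' & le p' p.
  move=> Cp; have [||_ [q [[Cq qp] ->]] qmin] := artinian_above_pow noethR localR (n := n)
    (F := fun K => exists q, (C q.1 q.2 /\ le q p) /\ K = sum_sub q.2 (ideal_pow m n)).
  - by exists (sum_sub p.2 (ideal_pow m n)), p.
  - by move=> _ [q [_ ->]] x; exact: mem_sum_subr.
  exists q => //; split => // q' Cq' q'q x xq.
  apply: (qmin (sum_sub q'.2 (ideal_pow m n))); last exact: mem_sum_subl.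
    by exists q'; split => //; split => //; exact: le_trans qp.
  by move=> _ /sum_subP[u [v [uq vm ->]]]; rewrite mem_sum_sub //; exact: (q'q.1).
have [|n p [Cp _]|p Pp ple] := @dependent_sequence _ P (fun n p p' => le p' p).
- by have [p' Pp' _] := minP 0%N (c0, I0) C0; exists p'.
- by have [p' Pp' p'p] := minP n.+1 p Cp; exists p'.
have [||y yP yS] := @dependent_sequence L
    (fun n y => y - (p n).1 \in ideal_mul (p n).2 (full L))
    (fun n y y' => y' - y \in adic m L n).
- by exists (p 0%N).1; rewrite subrr rpred0.
- move=> n y yn; have [pS pS1] := ple n.
  have : y - (p n.+1).1 \in ideal_mul (p n).2 (full L).
    by rewrite -(subrK (p n).1 y) -addrA rpredD // -opprB -scaleN1r rpredZ.
  have [_ /(_ (p n.+1))] := Pp n; have [CS _] := Pp n.+1.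
  move=> /(_ CS (ple n))/ideal_mul_sumS/[apply]/sum_subP[a [b [aI bm yE]]].
  exists ((p n.+1).1 + a); first by rewrite addrC addKr.
  have -> : (p n.+1).1 + a - y = - b.
    have -> : y = b + ((p n.+1).1 + a).
      by rewrite -(subrK (p n.+1).1 y) yE [a + b]addrC -addrA [a + _]addrC.
    by rewrite opprD addrCA subrr addr0.
  by rewrite -scaleN1r rpredZ.
have [|z zy] := completion_complete (x := y).
  by move=> t; apply/(coord_adic noethR).
exists z => c I CcI; apply: (flat_ideal_closed noethR localR flatL) => n.
have [Cn _] := Pp n.
have [c3 [I3 [C3 I31 I3n c31 c3n]]] := dir _ _ _ _ CcI Cn.
have [_ /(_ (c3, I3) C3)] := Pp n; move=> /(_ (conj I3n c3n))/ideal_mul_sumS nI3.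
have zn : z - y n \in adic m L n by apply/(coord_adic noethR).
have -> : z - c = (z - y n) + ((y n - (p n).1) - (c3 - (p n).1)) + (c3 - c).
  by rewrite opprB [y n - _ + _]addrA subrK !addrA !subrK.
rewrite rpredD //; last exact: mem_sum_subl.
rewrite rpredD //; first exact: mem_sum_subr.
have /nI3/sum_subP[a [b [aI bm ->]]] : y n - (p n).1 - (c3 - (p n).1) \in
    ideal_mul (p n).2 (full L) by rewrite rpredBs // yP.
rewrite mem_sum_sub //; exact: (ideal_mulS I31).
Qed.

(* G is read as the graph of a partial map from B to the completion. *)
Definition solution_preserving (B : lmodType R) (G : B * L -> Prop) : Prop :=
  forall (J : choiceType) (l : seq ({malg R[J]} * (B * L))%type),
  (forall e, e \in l -> G e.2) ->
  (exists h : J -> B, forall e, e \in l -> lin_ext h e.1 = e.2.1) ->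
  exists h : J -> L, forall e, e \in l -> lin_ext h e.1 = e.2.2.

Definition push (J K : choiceType) (u : J -> K) (g : {malg R[J]}) : {malg R[K]} :=
  lin_ext (fun j => << u j >>) g.

Lemma lin_ext_push (J K : choiceType) (V : lmodType R) (u : J -> K) (h : K -> V) g :
  lin_ext h (push u g) = lin_ext (h \o u) g.
Proof. by rewrite lin_ext_sub; apply: eq_lin_ext => j _; rewrite lin_extU. Qed.

Section OneStep.
Context (B : lmodType R) (G : B * L -> Prop) (b : B).
Hypotheses (goodG : solution_preserving G) (G0 : G (0, 0)).

(** The first list has right-hand sides that are pairs of the graph. The forms in the second list
    must all take the value [b] in B, and one common value [c] in L. *)
Definition extended_system (J : choiceType) := (seq ({malg R[J]} * (B * L)) * seq {malg R[J]})%type.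

Definition solves_source (J : choiceType) (s : extended_system J) (h : J -> B) :=
  (forall e, e \in s.1 -> lin_ext h e.1 = e.2.1) /\ (forall g, g \in s.2 -> lin_ext h g = b).
Definition solves_target (J : choiceType) (s : extended_system J) (h : J -> L) (c : L) :=
  (forall e, e \in s.1 -> lin_ext h e.1 = e.2.2) /\ (forall g, g \in s.2 -> lin_ext h g = c).
Definition solves_homogeneous (V : lmodType R) (J : choiceType)
    (s : extended_system J) (h : J -> V) (c : V) :=
  (forall e, e \in s.1 -> lin_ext h e.1 = 0) /\ (forall g, g \in s.2 -> lin_ext h g = c).

(** Treat [b] as a further unknown [None]: the condition on a form g becomes the equation g - [None]
    = 0, whose right-hand sides (0, 0) lie in G. *)
Lemma solves_target_ex (J : choiceType) (s : extended_system J) (h : J -> B) :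
  (forall e, e \in s.1 -> G e.2) -> solves_source s h -> exists c h', solves_target s h' c.
Proof.
move=> sG [h1 h2].
have [||h' h'P] := goodG (J := option J)
  (l := [seq (push some e.1, e.2) | e <- s.1] ++
        [seq (push some g - << None >>, (0, 0)) | g <- s.2]).
- by move=> e; rewrite mem_cat => /orP[/mapP[e' /sG ? ->]|/mapP[g gs ->]].
- exists (fun o => if o is Some j then h j else b) => e.
  rewrite mem_cat => /orP[/mapP[e' e's ->]|/mapP[g gs ->]] /=.
    by rewrite lin_ext_push; exact: h1.
  by rewrite linearB /= lin_ext_push lin_extU [X in X - _]h2 // subrr.
exists (h' None), (h' \o some); split.
  move=> e es; have /= := h'P (push some e.1, e.2); rewrite lin_ext_push; apply.
  by rewrite mem_cat; apply/orP; left; apply/mapP; exists e.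
move=> g gs; apply/eqP; rewrite -subr_eq0; apply/eqP.
have /= := h'P (push some g - << None >>, (0, 0)).
rewrite linearB /= lin_ext_push lin_extU; apply.
by rewrite mem_cat; apply/orP; right; apply/mapP; exists g.
Qed.

Lemma value_ideal (J : choiceType) (s : extended_system J) : exists I : submodClosed R^o,
  forall a : R^o, a \in I <-> exists k : J -> R^o, solves_homogeneous s k a.
Proof.
have [||I IP] := @mk_sub R R^o (fun a => exists k : J -> R^o, solves_homogeneous s k a).
- by exists (fun=> 0); split => e _; rewrite lin_ext0.
- move=> a u v [k [k1 k2]] [k' [k'1 k'2]]; exists (fun j => a *: k j + k' j).
  split => e es; rewrite lin_ext_combine ?k1 ?k'1 ?k2 ?k'2 //.
  by rewrite scaler0 addr0.
by exists I.
Qed.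

(** By flatness the values over L are those over R extended to L. Consequently the values [c] that a
    finite system permits form a coset of I L. *)
Lemma solves_homogeneous_mem (J : choiceType) (s : extended_system J) (I : submodClosed R^o) :
  (forall a : R^o, a \in I <-> exists k : J -> R^o, solves_homogeneous s k a) ->
  forall c : L, c \in ideal_mul I (full L) <-> exists h, solves_homogeneous s h c.
Proof.
move=> IP c; split.
  move: c; apply: span_ind.
  - by exists (fun=> 0); split => e _; rewrite lin_ext0.
  - move=> a u v [k [k1 k2]] [k' [k'1 k'2]]; exists (fun j => a *: k j + k' j).
    split => e es; rewrite lin_ext_combine ?k1 ?k'1 ?k2 ?k'2 //.
    by rewrite scaler0 addr0.
  - move=> _ [r /IP[k [k1 k2]] [v _ ->]].
    pose kv j : L := (k j : R) *: v.
    have kE g : lin_ext kv g = (lin_ext k g : R) *: v.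
      rewrite /lin_ext scaler_suml; apply: eq_bigr => j _.
      exact: scalerA.
    exists kv; split => e es; rewrite [LHS]kE.
      by rewrite k1 // scale0r.
    by rewrite k2.
case: s IP => l [|g1 s'] IP [h [h1 h2]].
  rewrite -[c]scale1r; apply: ideal_mulP => //; apply/IP.
  by exists (fun=> 0); split => [e el|//]; rewrite lin_ext0.
rewrite -(h2 g1) ?mem_head //.
apply: (flat_functional (gs := [seq e.1 | e <- l] ++ [seq g1 - g | g <- s'])) => //.
  move=> g; rewrite mem_cat => /orP[/mapP[e el ->]|/mapP[g' gs' ->]]; first exact: h1.
  by rewrite linearB /= !h2 ?subrr ?mem_head // inE gs' orbT.
move=> k kP; apply/IP; exists k; split.
  by move=> e el; apply: kP; rewrite mem_cat map_f.
move=> g; rewrite inE => /orP[/eqP -> //|gs'].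
apply/esym/eqP; rewrite -subr_eq0; apply/eqP.
have := kP (g1 - g); rewrite linearB; apply.
by rewrite mem_cat; apply/orP; right; apply/mapP; exists g.
Qed.

(** Each finite system confines the image of [b] to a coset of some I L, nonempty by
    [solves_target_ex]. Uniting two systems on disjoint unknowns shows these cosets to be directed,
    and [coset_inter] gives a common value. *)
Lemma one_step : exists y, solution_preserving (fun p => G p \/ p = (b, y)).
Proof.
pose C (c : L) (I : submodClosed R^o) := exists (J : choiceType) (s : extended_system J),
  [/\ forall e, e \in s.1 -> G e.2, exists h, solves_source s h, exists h, solves_target s h c &
      forall a : R^o, a \in I <-> exists k : J -> R^o, solves_homogeneous s k a].
have diff (J : choiceType) (s : extended_system J) h c h' c' :
    solves_target s h c -> solves_target s h' c' ->
    solves_homogeneous s (fun j => -1 *: h' j + h j) (c - c').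
  move=> [h1 h2] [h'1 h'2]; split => e es; rewrite lin_ext_combine.
    by rewrite h1 // h'1 // scaleN1r addNr.
  by rewrite h2 // h'2 // scaleN1r addrC.
have [||y yP] := @coset_inter C.
- have [I IP] := value_ideal (([::], [::]) : extended_system void).
  exists 0, I, void, ([::], [::]); split => //; by exists (of_void _).
- move=> c1 I1 c2 I2 [J1 [s1 [s1G [hB1 hB1P] [hL1 hL1P] IP1]]]
    [J2 [s2 [s2G [hB2 hB2P] [hL2 hL2P] IP2]]].
  pose s : extended_system (J1 + J2)%type :=
    ([seq (push inl e.1, e.2) | e <- s1.1] ++ [seq (push inr e.1, e.2) | e <- s2.1],
     [seq push inl g | g <- s1.2] ++ [seq push inr g | g <- s2.2]).
  have sG e : e \in s.1 -> G e.2.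
    by rewrite mem_cat => /orP[/mapP[e' /s1G ? ->]|/mapP[e' /s2G ? ->]].
  pose hB (k : J1 + J2) := match k with inl j => hB1 j | inr j => hB2 j end.
  have hBP : solves_source s hB.
    split => e; rewrite mem_cat => /orP[/mapP[e' e's ->]|/mapP[e' e's ->]];
      rewrite lin_ext_push.
    + exact: hB1P.1. + exact: hB2P.1. + exact: hB1P.2. + exact: hB2P.2.
  have [c [h hP]] := solves_target_ex sG hBP.
  have [I IP] := value_ideal s.
  have r1 (V : lmodType R) (k : J1 + J2 -> V) (pr : B * L -> V) (c' : V) :
      (forall e, e \in s.1 -> lin_ext k e.1 = pr e.2) ->
      (forall g, g \in s.2 -> lin_ext k g = c') ->
      [/\ forall e, e \in s1.1 -> lin_ext (k \o inl) e.1 = pr e.2,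
        forall g, g \in s1.2 -> lin_ext (k \o inl) g = c',
        forall e, e \in s2.1 -> lin_ext (k \o inr) e.1 = pr e.2 &
        forall g, g \in s2.2 -> lin_ext (k \o inr) g = c'].
    move=> k1 k2; split => e es; rewrite -lin_ext_push.
    + by apply: (k1 (push inl e.1, e.2)); rewrite mem_cat; apply/orP; left; apply/mapP; exists e.
    + by apply: k2; rewrite mem_cat map_f.
    + by apply: (k1 (push inr e.1, e.2)); rewrite mem_cat; apply/orP; right; apply/mapP; exists e.
    + by apply: k2; rewrite mem_cat map_f ?orbT.
  have [q1 q2 q3 q4] := r1 _ h snd c hP.1 hP.2.
  exists c, I; split.
  + by exists (J1 + J2)%type, s; split => //; [exists hB | exists h].
  + move=> a /IP[k [k1 k2]]; have [p1 p2 _ _] := r1 _ k (fun=> 0) a k1 k2.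
    by apply/IP1; exists (k \o inl).
  + move=> a /IP[k [k1 k2]]; have [_ _ p1 p2] := r1 _ k (fun=> 0) a k1 k2.
    by apply/IP2; exists (k \o inr).
  + apply/(solves_homogeneous_mem IP1); exists (fun j => -1 *: hL1 j + (h \o inl) j).
    exact: diff.
  + apply/(solves_homogeneous_mem IP2); exists (fun j => -1 *: hL2 j + (h \o inr) j).
    exact: diff.
exists y => J l lG [h hl].
pose s : extended_system J := ([seq e <- l | `[< G e.2 >]], [seq e.1 | e <- l & e.2 == (b, y)]).
have sG e : e \in s.1 -> G e.2 by rewrite mem_filter => /andP[/asboolP].
have hP : solves_source s h.
  split => [e|g]; first by rewrite mem_filter => /andP[_ /hl].
  by move=> /mapP[e + ->]; rewrite mem_filter => /andP[/eqP ey /hl ->]; rewrite ey.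
have [c [h' h'P]] := solves_target_ex sG hP.
have [I IP] := value_ideal s.
have : y - c \in ideal_mul I (full L).
  by apply: yP; exists J, s; split => //; [exists h | exists h'].
move=> /(solves_homogeneous_mem IP)[k [k1 k2]]; exists (fun j => k j + h' j) => e el.
rewrite lin_extD; case: (pselect (G e.2)) => [Ge|nGe].
  have es : e \in s.1 by rewrite mem_filter el andbT; apply/asboolP.
  by rewrite k1 // h'P.1 // add0r.
have [//|ey] := lG e el.
have es : e.1 \in s.2 by apply/mapP; exists e => //; rewrite mem_filter el andbT; apply/eqP.
by rewrite k2 // h'P.2 // subrK ey.
Qed.

End OneStep.

(** A maximal solution-preserving relation containing the graph of [f] is total by [one_step];
    systems in one and two unknowns show it to be single-valued and linear. *)
Lemma flat_completion_ext (A B : lmodType R) (j : {linear A -> B}) (f : {linear A -> L}) :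
  injective j -> eqpure (image_sub j (full A)) ->
  exists g : {linear B -> L}, forall a, g (j a) = f a.
Proof.
move=> ji jp; pose G0 (p : B * L) := exists a, p = (j a, f a).
have G00 : G0 (0, 0) by exists 0; rewrite !linear0.
have good0 : solution_preserving G0.
  move=> J l lG [h hl].
  have H e : e \in l -> exists e' : {malg R[J]} * A, [/\ e'.1 = e.1, e.2.1 = j e'.2 &
      e.2.2 = f e'.2].
    by move=> /lG[a ->]; exists (e.1, a).
  have [l' H1 H2] := lift_list H.
  have [||h' h'A h'l] := jp J [seq (e.1, j e.2) | e <- l'].
  - by move=> _ /mapP[e _ ->]; exact: mem_image_sub.
  - by exists h => _ /mapP[e /H1[e0 e0l [/= -> <- _]] ->] /=; exact: hl.
  have /choice[r rE] : forall k, exists a, h' k = j a.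
    by move=> k; have [a _ ->] := image_subP (h'A k); exists a.
  exists (f \o r) => e el; have [e' e'l [e1 _ ->]] := H2 e el.
  rewrite -e1 -lin_ext_comp; congr (f _); apply: ji.
  rewrite lin_ext_comp; have /= <- := h'l (e'.1, j e'.2) _; last by apply/mapP; exists e'.
  by apply: eq_lin_ext => k _; rewrite rE.
pose P (S : classical_sets.set (B * L)) := solution_preserving (fun p => G0 p \/ S p).
have [F FP Ftot|S [PS Smax]] := @classical_sets.Zorn_bigcup (B * L)%type P.
  move=> J l lG.
  suff [S [gS lS]] : exists S, solution_preserving (fun p => G0 p \/ S p) /\
      (forall e, e \in l -> G0 e.2 \/ S e.2) by exact: gS.
  (* A finite system involves finitely many members of the chain, so one of them suffices; the empty
     set serves when none is involved. *)
  suff [S [[FS|S0] lS]] : exists S : classical_sets.set (B * L),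
      (F S \/ S = fun=> False) /\ (forall e, e \in l -> G0 e.2 \/ S e.2).
  - by exists S; split => //; exact: FP.
  - exists S; split => //; have -> // : (fun p => G0 p \/ S p) = G0.
    by apply: funext => p; apply/propext; rewrite S0; split => [[]|] //; left.
  elim: l lG => [|e l IH] lG; first by exists (fun=> False); split => //; right.
  have [|S [FS lS]] := IH; first by move=> e' e'l; apply: lG; rewrite inE e'l orbT.
  have [Ge|[S' FS' S'e]] := lG e (mem_head _ _).
    by exists S; split => // e'; rewrite inE => /orP[/eqP ->|/lS //]; left.
  have [SS'|S'S] : (forall p, S p -> S' p) \/ (forall p, S' p -> S p).
  - case: FS => [FS|->]; last by left.
    by have [|] := Ftot _ _ FS FS'; [left | right].
  - exists S'; split; first by left.
    move=> e'; rewrite inE => /orP[/eqP ->|/lS[|/SS']]; by [right|left|right].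
  - exists S; split => // e'; rewrite inE => /orP[/eqP ->|/lS //].
    by right; exact: S'S.
pose G p := G0 p \/ S p.
have Gtot b : exists y, G (b, y).
  have [|y gy] := one_step b PS; first by left.
  exists y; apply: contrapT => nG; apply: (Smax (fun p => S p \/ p = (b, y))).
    split; first by move=> p Sp; left.
    by move=> H; apply: nG; right; apply: H; right.
  rewrite /P; have -> // : (fun p => G0 p \/ (S p \/ p = (b, y))) =
      (fun p => (G0 p \/ S p) \/ p = (b, y)).
  apply: funext => p; apply/propext.
  by split => [[?|[?|?]]|[[?|?]|?]]; auto.
have /choice[g gG] := Gtot.
have Gfun b y y' : G (b, y) -> G (b, y') -> y = y'.
  move=> Gy Gy'.
  have [||h hl] := PS unit [:: (<< tt >>, (b, y)); (<< tt >>, (b, y'))].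
  - by move=> e; rewrite !inE => /orP[] /eqP ->.
  - by exists (fun=> b) => e; rewrite !inE => /orP[] /eqP -> /=; rewrite lin_extU.
  have := hl (<< tt >>, (b, y)); have := hl (<< tt >>, (b, y')).
  rewrite /= lin_extU !inE !eqxx orbT => <- // <- //.
have [|g' g'E] := @mk_linear R B L g.
  move=> a x y.
  have [||h hl] := PS bool [:: (<< true >>, (x, g x)); (<< false >>, (y, g y));
      (a *: << true >> + << false >>, (a *: x + y, g (a *: x + y)))].
  - by move=> e; rewrite !inE => /or3P[] /eqP ->; exact: gG.
  - exists (fun t : bool => if t then x else y) => e.
    by rewrite !inE => /or3P[] /eqP -> /=; rewrite ?lin_ext_linear !lin_extU.
  have := hl (<< true >>, (x, g x)); rewrite /= lin_extU inE eqxx => <- //.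
  have := hl (<< false >>, (y, g y)); rewrite /= lin_extU !inE eqxx orbT => <- //.
  have := hl (a *: << true >> + << false >>, (a *: x + y, g (a *: x + y))).
  by rewrite /= lin_ext_linear !lin_extU !inE eqxx !orbT => <-.
exists g' => a; rewrite g'E; apply: (Gfun (j a)); first exact: gG.
by left; exists a.
Qed.

End FlatCompletion.

(** * The free module on a basis of M/mM *)

Lemma lin_ideal_mul (R : comNzRingType) (V W : lmodType R) (f : {linear V -> W})
    (I : {pred R}) (X : submodClosed V) (Y : submodClosed W) :
  (forall x, x \in X -> f x \in Y) -> forall x, x \in ideal_mul I X -> f x \in ideal_mul I Y.
Proof.
move=> XY; apply: span_ind; first by rewrite linear0 rpred0.
  by move=> a u v uI vI; rewrite linearP rpredD // rpredZ.
by move=> _ [r rI [x xX ->]]; rewrite linearZ /=; apply: ideal_mulP => //; exact: XY.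
Qed.

Lemma mcoeff_lin_ext (R : comNzRingType) (J K : choiceType) (u : J -> {malg R[K]}) g k :
  (lin_ext u g)@_k = lin_ext (fun j => (u j)@_k : R^o) g.
Proof.
rewrite /lin_ext raddf_sum; apply: eq_bigr => j _.
exact: mcoeffZ.
Qed.

Lemma mcoeff_push (R : comNzRingType) (J K : choiceType) (u : J -> K) (g : {malg R[J]}) j :
  injective u -> (push u g)@_(u j) = g@_j.
Proof.
move=> ui; rewrite mcoeff_lin_ext.
apply: etrans (etrans (lin_ext_single j (1 : R^o) g) (mulr1 _)).
by apply: eq_lin_ext => j' _; rewrite mcoeffU (inj_eq ui) /=; case: (_ == _).
Qed.

Section Basis.
Context {R : comNzRingType} {m : {pred R}} {M : lmodType R}.
Local Notation L := (completion m M).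
Hypotheses (noethR : noetherian R) (localR : local_ring m).

(** Zorn's lemma for sets independent modulo mM. For x outside a maximal set S, a dependence on S
    and x has a unit as coefficient of x, so x is a combination of S modulo mM. *)
Lemma basis_mod_maximal : exists (J : choiceType) (v : J -> M),
  (forall c : {malg R[J]}, lin_ext v c \in ideal_mul m (full M) -> forall j, c@_j \in m) /\
  (forall x, exists c : {malg R[J]}, x - lin_ext v c \in ideal_mul m (full M)).
Proof.
have [mI mE] := maximal_ideal_sub localR.
have m0 : 0 \in m by rewrite mE; exact: rpred0.
pose indep (S : classical_sets.set M) := forall c : {malg R[M]},
  (forall x, x \in msupp c -> S x) -> lin_ext id c \in ideal_mul m (full M) ->
  forall x, c@_x \in m.
have [F FP Ftot|S [Si Smax]] := @classical_sets.Zorn_bigcup M indep.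
  move=> c cF.
  suff [S [FS cS]] : exists S : classical_sets.set M, (F S \/ S = fun=> False) /\
      (forall x, x \in enum_fset (msupp c) -> S x).
    case: FS => [FS|S0]; first exact: (FP S FS).
    by move=> _ x; case: msuppP => // xc; have := cS x xc; rewrite S0.
  elim: (enum_fset _) {cF}(cF : forall x, x \in enum_fset (msupp c) -> _) => [_|x l IH lF].
    by exists (fun=> False); split => //; right.
  have [|S [FS lS]] := IH; first by move=> y yl; apply: lF; rewrite inE yl orbT.
  have [S' FS' S'x] := lF x (mem_head _ _).
  have [SS'|S'S] : (forall p, S p -> S' p) \/ (forall p, S' p -> S p).
  - case: FS => [FS|->]; last by left.
    by have [|] := Ftot _ _ FS FS'; [left | right].
  - exists S'; split; first by left.
    by move=> y; rewrite inE => /orP[/eqP ->|/lS/SS'].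
  - by exists S; split => // y; rewrite inE => /orP[/eqP ->|/lS //]; exact: S'S.
have Sgen x : exists2 c : {malg R[M]}, forall y, y \in msupp c -> S y &
    x - lin_ext id c \in ideal_mul m (full M).
  have [Sx|nSx] := pselect (S x).
    exists << x >>; last by rewrite lin_extU subrr rpred0.
    by move=> y /(fsubsetP msuppU_le); rewrite inE => /eqP ->.
  have : ~ indep (fun y => S y \/ y = x).
    apply: Smax; split; first by move=> y Sy; left.
    by move=> H; apply: nSx; apply: H; right.
  move=> /existsNP[c /not_implyP[cS /not_implyP[cm /existsNP[y /negP yc]]]].
  pose a := c@_x; pose c' := c - a *: << x >>.
  have c'E z : c@_z = c'@_z + a *+ (x == z).
    by rewrite mcoeffB mcoeffZ mcoeffU mulrnAr mulr1 subrK.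
  have c'S z : z \in msupp c' -> S z.
    rewrite -mcoeff_neq0 => c'z; have c'zE := c'E z.
    case: (eqVneq x z) c'zE => [xz|xz] c'zE.
      move: c'zE c'z; rewrite -xz mulr1n -[c@_x]add0r => /addIr <-.
      by rewrite eqxx.
    move: c'zE; rewrite mulr0n addr0 => c'zE.
    have [|//|zx] := cS z; first by rewrite -mcoeff_neq0 c'zE.
    by rewrite zx eqxx in xz.
  have c'l : lin_ext id c' = lin_ext id c - a *: x.
    by rewrite linearB linearZ /= lin_extU.
  have am : a \notin m.
    apply/negP => am; move/negP: yc; apply.
    have c'm : lin_ext id c' \in ideal_mul m (full M).
      by rewrite c'l rpredBs //; apply: ideal_mulP.
    have := Si c' c'S c'm y; rewrite c'E !mE => c'y; apply: (rpredD c'y).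
    by case: (_ == _); [rewrite mulr1n -mE | exact: rpred0].
  have [b ba] := local_unit noethR localR am.
  exists (- (b *: c')) => [z|].
    rewrite msuppN => /(fsubsetP (msuppZ_le _ _)); exact: c'S.
  have -> : x - lin_ext id (- (b *: c')) = b *: lin_ext id c.
    rewrite linearN linearZ /= opprK c'l scalerBr scalerA ba scale1r.
    by rewrite addrC subrK.
  exact: rpredZ.
pose J : choiceType := {x : M | `[< S x >]}.
exists J, val; split=> [c cm j|x].
  rewrite -(mcoeff_push c j val_inj); apply: Si; last by rewrite lin_ext_push.
  move=> y; rewrite -mcoeff_neq0 mcoeff_lin_ext => yc; apply: contrapT => nSy.
  move/eqP: yc; apply; apply: etrans (lin_ext0 (V := R^o) c).
  apply: eq_lin_ext => k _; rewrite mcoeffU; case: eqP => // ky.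
  by case: nSy; rewrite -ky; exact/asboolP/(valP k).
have [c cS xc] := Sgen x.
have /choice[f fE] : forall y, exists f : {malg R[J]}, S y -> lin_ext val f = y.
  move=> y; have [Sy|nS] := pselect (S y); last by exists 0.
  have Sy' : `[< S y >] by apply/asboolP.
  by exists << exist (fun x => `[< S x >]) y Sy' : J >> => _; rewrite lin_extU.
exists (lin_ext f c); rewrite lin_ext_sub.
have -> // : lin_ext (fun k => lin_ext val (f k)) c = lin_ext id c.
by apply: eq_lin_ext => k kc; rewrite fE //; exact: cS.
Qed.

Hypotheses (flatL : flat L).
Context (J : choiceType) (v : J -> M).
Hypotheses (v_free : forall c : {malg R[J]},
  lin_ext v c \in ideal_mul m (full M) -> forall j, c@_j \in m).

Lemma to_completion_ideal_mul x :
  to_completion x \in ideal_mul m (full L) -> x \in ideal_mul m (full M).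
Proof.
move=> xm; have : to_completion x \in adic m L 1.
  move: xm; apply: ideal_mul_sub => r y rm _; apply: ideal_mulP => //.
  by rewrite -[r]mulr1; apply: (@ideal_mulP _ m R^o).
move=> /(coord_adic noethR); rewrite coord_to_completion => /quot_pi0.
apply: ideal_mul_sub => r y + _.
have [K KP] := colon_ideal (ideal_mul m (full M)) y.
move=> r1; apply/KP; apply: (ideal_mul_sub (I := m)) r1 => a b am _; apply/KP.
by rewrite [a *: b]mulrC -scalerA rpredZ //; apply: ideal_mulP.
Qed.

Local Notation vec k := (prodmod (fun _ : 'I_k => R^o)).

(* Noetherian induction on U: if U is maximal among the counterexamples, all  *)
(* coefficient vectors lie in U + R w for one of them, w not in U, and then   *)
(* (U : w) L contains a combination of the basis with a coefficient 1.        *)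
Lemma basis_coefficients k (U : submodClosed (vec k)) (c : 'I_k -> {malg R[J]})
    (l : seq (vec k * L)) :
  (forall e, e \in l -> e.1 \in U) ->
  (forall i, to_completion (lin_ext v (c i)) = \sum_(e <- l) (e.1 i : R) *: e.2) ->
  forall x, ((fun i => (c i)@_x) : vec k) \in U.
Proof.
pose bad (U : submodClosed (vec k)) := exists (c : 'I_k -> {malg R[J]}) (l : seq (vec k * L)),
  [/\ forall e, e \in l -> e.1 \in U,
      forall i, to_completion (lin_ext v (c i)) = \sum_(e <- l) (e.1 i : R) *: e.2 &
      exists x, ((fun i => (c i)@_x) : vec k) \notin U].
suff nbad : ~ exists U, bad U.
  move=> lU cl x; apply: contrapT => /negP xU; apply: nbad; exists U, c, l.
  by split => //; exists x.
move=> /(noeth_max (noetherian_power (k := k) noethR))[{}U [{}c [{}l [lU cl [x0]]]]].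
set w : vec k := (X in X \notin U) => wU Umax.
pose U' := sum_sub U (span (fun y => y = w)).
have wU' : w \in U' by apply: mem_sum_subr; exact: mem_span.
have good x : ((fun i => (c i)@_x) : vec k) \in U'.
  apply: contrapT => /negP xU'; move/negP: wU; apply; apply: (Umax U') => //.
    exists c, l; split => // [e /lU|]; first exact: mem_sum_subl.
    by exists x.
  by move=> y yU; exact: mem_sum_subl.
have dec x : exists a : R, ((fun i => (c i)@_x - a * w i) : vec k) \in U.
  have [u [z [uU zw xE]]] := sum_subP (good x).
  have [a az] : exists a : R, z = a *: w.
    move: z zw {xE}; apply: span_ind; first by exists 0; rewrite scale0r.
      by move=> b y z [a ->] [a' ->]; exists (b * a + a'); rewrite scalerDl scalerA.
    by move=> _ ->; exists 1; rewrite scale1r.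
  exists a; suff -> : ((fun i => (c i)@_x - a * w i) : vec k) = u by [].
  apply: functional_extensionality_dep => i.
  by have := congr1 (fun f : vec k => f i) xE; rewrite prodE az /= => ->; exact: addrK.
(* At [x0] the coefficient vector is w itself, so the multiplier there can be chosen to be 1. *)
have [a aU] : exists a : J -> R, a x0 = 1 /\
    forall x, ((fun i => (c i)@_x - a x * w i) : vec k) \in U.
  have [a aU] := choice dec; exists (fun x => if x == x0 then 1 else a x).
  split=> [|x]; first by rewrite eqxx.
  case: eqP => [->|_] //.
  suff -> : ((fun i => (c i)@_x0 - 1 * w i) : vec k) = 0 by exact: rpred0.
  by apply: functional_extensionality_dep => i; rewrite mul1r subrr.
pose d := (\bigcup_(i <- enum 'I_k) msupp (c i))%fset.
have dsub i : fsubset (msupp (c i)) d by apply: bigfcup_sup; rewrite ?mem_enum.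
have x0d : x0 \in d.
  apply: contrapT => /negP x0d; move/negP: wU; apply.
  suff -> : w = 0 by exact: rpred0.
  apply: functional_extensionality_dep => i; apply: mcoeff_outdom.
  by apply: contra x0d; exact/fsubsetP.
pose A : {malg R[J]} := \sum_(x <- d) a x *: << x >>.
have Ax0 : A@_x0 = 1.
  rewrite raddf_sum /= (big_fsetD1 x0) //= mcoeffZ mcoeffUU mulr1 aU.1 big1_fset ?addr0 //.
  by move=> x; rewrite !inE mcoeffZ mcoeffU => /andP[/negPf -> _] _; rewrite mulr0.
pose y : L := to_completion (lin_ext v A).
have yE : y = \sum_(x <- d) a x *: to_completion (v x).
  have AE : lin_ext v A = \sum_(x <- d) a x *: v x.
    by rewrite linear_sum; apply: eq_bigr => x _; rewrite linearZ /= lin_extU.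
  by rewrite /y AE linear_sum; apply: eq_bigr => x _; rewrite linearZ.
pose u x : vec k := fun i => (c i)@_x - a x * w i.
pose l' := l ++ [seq (- u x, to_completion (v x)) | x <- d].
have l'U e : e \in l' -> e.1 \in U.
  rewrite mem_cat => /orP[/lU //|/mapP[x _ ->]] /=.
  by rewrite -scaleN1r rpredZ // aU.2.
have wy i : w i *: y = \sum_(e <- l') (e.1 i : R) *: e.2.
  rewrite big_cat -cl big_map /= (lin_ext_wider _ (dsub i)) linear_sum -big_split yE scaler_sumr.
  apply: eq_bigr => x _ /=; rewrite [to_completion (_ *: _)]linearZ scalerA.
  rewrite -[(- u x) i]/(- ((c i)@_x - a x * w i)) -[LHS]/((w i * a x) *: _) /=.
  by rewrite -scalerDl opprB [_ + (_ - _)]addrC subrK mulrC.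
have [K KP] := colon_ideal U w.
(* By [wy] the vector w y lies in U L, so flatness puts y in (U : w) L. That ideal is proper since w
   is not in U; thus y is in mL, although [A] has coefficient 1 at [x0]. *)
have yK : y \in ideal_mul K (full L).
  pose T : choiceType := option (vec k * L)%type.
  pose g i : {malg R[T]} := w i *: << None >> - \sum_(e <- l') (e.1 i : R) *: << Some e >>.
  have gE (V : lmodType R) (h : T -> V) i : lin_ext h (g i) =
      (w i : R) *: h None - \sum_(e <- l') (e.1 i : R) *: h (Some e).
    rewrite linearB linearZ /= lin_extU; congr (_ - _); rewrite linear_sum.
    by apply: eq_bigr => e _; rewrite linearZ /= lin_extU.
  pose h (t : T) : L := if t is Some e then e.2 else y.
  have -> : y = lin_ext h << None >> by rewrite lin_extU.
  apply: (flat_functional (gs := [seq g i | i <- enum 'I_k])) => //.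
    by move=> _ /mapP[i _ ->]; rewrite gE /= wy subrr.
  move=> q qg; rewrite lin_extU; apply/KP.
  have -> : (q None : R) *: w = \sum_(e <- l') (q (Some e) : R) *: e.1.
    apply: functional_extensionality_dep => i; rewrite prod_sumE.
    have := qg (g i); rewrite gE map_f ?mem_enum // => /(_ isT)/eqP.
    rewrite subr_eq0 => /eqP e; rewrite prodZE.
    apply: etrans (etrans (mulrC _ _) e) _.
    by apply: eq_bigr => e' _; exact: mulrC.
  exact: rpred_comb.
have K1 : (1 : R) \notin K by apply: contra wU => /KP; rewrite scale1r.
have : A@_x0 \in m.
  apply: v_free; apply: to_completion_ideal_mul; move: yK; apply: ideal_mul_sub => r z rK _.
  by apply: ideal_mulP => //; exact: (proper_sub_m noethR localR K1).
by rewrite Ax0; apply/negP; exact: one_notin_m localR.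
Qed.

Lemma basis_injective : injective (fun c : {malg R[J]} => to_completion (lin_ext v c) : L).
Proof.
move=> c c' /eqP; rewrite -subr_eq0 -!linearB => /eqP c0.
apply/eqP; rewrite -subr_eq0; apply/eqP/malgP => x.
pose U : submodClosed (vec 1) := span (fun _ => False).
have := @basis_coefficients 1 U (fun=> c - c') [::] _ _ x.
have U0 z : z \in U -> z = 0.
  by move: z; apply: span_ind => // a u z -> ->; rewrite scaler0 addr0.
move=> H; have /U0 : ((fun=> (c - c')@_x) : vec 1) \in U.
  by apply: H => // i; rewrite big_nil.
by move=> /(congr1 (fun f : vec 1 => f ord0)) ->; rewrite mcoeff0.
Qed.

(** By [basis_coefficients] the coefficient vectors of the right-hand sides lie in the span U of the
    columns; this solves the system one basis element at a time. *)
Lemma basis_eqpure (s : {linear {malg R[J]} -> L}) :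
  (forall c, s c = to_completion (lin_ext v c)) -> eqpure (image_sub s (full _)).
Proof.
move=> sE J2 l lA [h hl].
pose k := size l.
pose g (i : 'I_k) : {malg R[J2]} := (tnth (in_tuple l) i).1.
have /choice[c cE] : forall i : 'I_k, exists c, (tnth (in_tuple l) i).2 = s c.
  by move=> i; have [c _ ->] := image_subP (lA _ (mem_tnth i (in_tuple l))); exists c.
have hg i : lin_ext h (g i) = s (c i) by rewrite -cE; apply/hl/mem_tnth.
pose u j : vec k := fun i => (g i)@_j.
pose U := span (fun w : vec k => exists j, w = u j).
pose d := (\bigcup_(i <- enum 'I_k) msupp (g i))%fset.
have dsub i : fsubset (msupp (g i)) d by apply: bigfcup_sup; rewrite ?mem_enum.
have cU := @basis_coefficients k U c [seq (u j, h j) | j <- d].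
have {}cU x : ((fun i => (c i)@_x) : vec k) \in U.
  apply: cU => [e /mapP[j _ ->]|i]; first by apply: mem_span; exists j.
  by rewrite -sE -hg big_map (lin_ext_wider _ (dsub i)).
have /choice[q qE] : forall x, exists q : J2 -> R^o, forall i, (c i)@_x = lin_ext q (g i).
  move=> x; have := cU x; have UP : forall w : vec k, w \in U ->
     exists q : J2 -> R^o, forall i, w i = lin_ext q (g i).
    apply: span_ind.
    - by exists (fun=> 0) => i; rewrite lin_ext0.
    - move=> a w w' [q qE] [q' q'E]; exists (fun j => a *: q j + q' j) => i.
      by rewrite prodE prodZE lin_ext_combine qE q'E.
    - move=> _ [j ->]; exists (fun j' => if j' == j then 1 else 0) => i.
      by rewrite lin_ext_single; exact: esym (mulr1 _).
  by move=> /UP.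
pose dc := (\bigcup_(i <- enum 'I_k) msupp (c i))%fset.
have dcsub i : fsubset (msupp (c i)) dc by apply: bigfcup_sup; rewrite ?mem_enum.
pose h' j : {malg R[J]} := \sum_(x <- dc) (q x j : R) *: << x >>.
exists (s \o h') => [j|e el]; first exact: mem_image_sub.
have [i ei] := (tnthP (in_tuple l) e el).
rewrite -lin_ext_comp ei cE; congr (s _).
rewrite -[RHS]lin_ext_id (lin_ext_wider _ (dcsub i)) /lin_ext /h'.
under eq_bigr do rewrite scaler_sumr.
rewrite exchange_big; apply: eq_bigr => x _ /=; rewrite qE /lin_ext scaler_suml.
by apply: eq_bigr => j _; rewrite scalerA.
Qed.

End Basis.

(** * The hull of a separated module with flat completion *)

Section Hull.
Context {R : comNzRingType} {m : {pred R}} {M N : lmodType R} (i : {linear M -> N}).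
Local Notation L := (completion m M).
Hypotheses (noethR : noetherian R) (localR : local_ring m).
Hypotheses (flatL : flat L) (hullN : pure_injective_hull i).

Lemma mul_adicS (V : lmodType R) n a x :
  a \in m -> x \in adic m V n -> a *: x \in adic m V n.+1.
Proof.
move=> am; have [K KP] := colon_sub (adic m V n.+1) a.
move=> xn; apply/KP; apply: ideal_mul_sub xn => r v rn _; apply/KP.
by rewrite scalerA; apply: ideal_mulP => //; exact: (@ideal_mulP _ m R^o).
Qed.

Lemma lin_adic (V W : lmodType R) (f : {linear V -> W}) n x :
  x \in adic m V n -> f x \in adic m W n.
Proof. exact: lin_ideal_mul. Qed.

(** g comes from [flat_completion_ext], h from pure-injectivity of N along F -> L. On F the maps [i]
    and h agree, so on M = F + mM they differ by elements of mN. *)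
Lemma hull_splitting : exists (g : {linear N -> L}) (h : {linear L -> N}),
  [/\ forall x, g (i x) = to_completion x, forall z, g (h z) = z &
      forall x, i x - h (to_completion x) \in ideal_mul m (full N)].
Proof.
have [ii [ip _] pN] := hullN.
have [J [v [v_free v_gen]]] := @basis_mod_maximal R m M noethR localR.
have [s us sE] := maximal_ideal_gens noethR localR.
have [g gE] := flat_completion_ext noethR localR flatL (@to_completion R m M) ii (pure_eqpure ip).
pose sL : {linear {malg R[J]} -> L} := @to_completion R m M \o lin_ext v.
have sLE c : sL c = to_completion (lin_ext v c) by [].
have sLi : injective sL by exact: (basis_injective noethR localR flatL v_free).
have sLp := eqpure_pure (basis_eqpure noethR localR flatL v_free sLE).
have [h hE] := pure_ext (i \o lin_ext v : {linear {malg R[J]} -> N}) pN sLi sLp.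
have {}hE c : h (to_completion (lin_ext v c)) = i (lin_ext v c) by exact: hE.
exists g, h; split => // [z|x]; last first.
  have [c xc] := v_gen x.
  have -> : i x - h (to_completion x) =
      i (x - lin_ext v c) - h (to_completion (x - lin_ext v c)).
    by rewrite !linearB hE opprK addrA [RHS]addrAC subrK.
  rewrite rpredBs //; first exact: lin_ideal_mul xc.
  by apply: (lin_ideal_mul (f := h) (X := full L)) => //; exact: lin_ideal_mul xc.
have [|k kE] := @mk_linear R L L (fun z => g (h z) - z).
  by move=> a x y; rewrite !linearP scalerDr addrACA.
(* k = g h - 1 vanishes on F and M = F + mM, so each round gains a factor m. *)
have key n x : k (to_completion x) \in adic m L n.
  elim: n x => [|n IH] x; first exact: adic0.
  have [c] := v_gen x; move=> /(ideal_mul_gens _ us sE)[y _ xE].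
  have -> : x = \sum_(q <- s) q *: y q + lin_ext v c by rewrite -xE subrK.
  rewrite !linearD [X in _ + X]kE hE gE subrr addr0 !linear_sum big_seq rpred_sum // => q qs.
  rewrite !linearZ /=; apply: mul_adicS => //.
  by rewrite sE; exact: (@mem_span R R^o (fun x => x \in s)).
apply/eqP; rewrite -subr_eq0; apply/eqP/(completion_separated noethR) => n.
have [x /(coord_adic noethR) zx] := coord_approx n z.
rewrite -kE -(subrK (to_completion x) z) linearD rpredD //; first exact: lin_adic.
exact: key.
Qed.

(** The difference of [i] and h on M extends to d : N -> mN, so e = h g + d fixes M and is onto.
    Modulo mN the image of e is h L, and L = M + mL brings it into M. *)
Lemma hull_sum_ideal_mul n : exists x, n - i x \in ideal_mul m (full N).
Proof.
have [ii [ip _] /pinj_alg_compact cN] := hullN.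
have [g [h [gE gh hm]]] := hull_splitting.
have [s us sE] := maximal_ideal_gens noethR localR.
pose C : lmodType R := submod (ideal_mul m (full N)).
pose p0 x : C := exist (fun z => z \in ideal_mul m (full N)) _ (hm x).
have [|p pE] := @mk_linear R M C p0.
  move=> a x y; apply: val_inj.
  transitivity (a *: (i x - h (to_completion x)) + (i y - h (to_completion y))); last by [].
  by rewrite /= !linearP scalerDr addrACA.
have [d dE] := alg_compact_ext p (ideal_mul_alg_compact us sE cN) ii (pure_eqpure ip).
have [|e eE] := @mk_linear R N N (fun n => h (g n) + incl (ideal_mul m (full N)) (d n)).
  by move=> a x y; rewrite !linearP scalerDr addrACA.
have {}eE n' : e n' = h (g n') + val (d n') by exact: eE.
have [|n' <-] := hull_endo_surj hullN (e := e) _ n.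
  by move=> x; rewrite eE gE dE pE /= addrC subrK.
have [x /(coord_adic noethR) zx] := coord_approx 1 (g n').
exists x.
have -> : e n' - i x = h (g n' - to_completion x) + (val (d n') - (i x - h (to_completion x))).
  by rewrite eE linearB opprB [in RHS](addrCA (val (d n'))) [RHS]addrA subrK [RHS]addrA.
rewrite rpredD //; last by rewrite rpredBs //; exact: (valP (d n')).
apply: (lin_ideal_mul (f := h) (X := full L)) => //.
move: zx; apply: ideal_mul_sub => r y + _.
have [K KP] := colon_ideal (ideal_mul m (full L)) y.
move=> r1; apply/KP; apply: (ideal_mul_sub (I := m)) r1 => a b am _; apply/KP.
by rewrite [a *: b]mulrC -scalerA rpredZ //; apply: ideal_mulP.
Qed.

Lemma hull_quotient_radical_full : radical_full m (quotmod (image_sub i (full M))).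
Proof.
move=> q; rewrite mem_full; have [n ->] := quot_pi_surj q.
have [x nx] := hull_sum_ideal_mul n.
have -> : quot_pi (image_sub i (full M)) n = quot_pi _ (n - i x).
  by apply/quot_piP; rewrite opprB addrC subrK; exact: mem_image_sub.
exact: lin_ideal_mul nx.
Qed.

(** Let p = 1 - h g be the projection onto ker g. Since N = M + mN and p maps M into mN, one gets
    ker g = p(mN) = m ker g, so ker g lies in every m^k N. *)
Lemma hull_H (g : {linear N -> L}) (h : {linear L -> N}) :
  (forall x, g (i x) = to_completion x) -> (forall z, g (h z) = z) ->
  (forall x, i x - h (to_completion x) \in ideal_mul m (full N)) ->
  forall n, n \in H m N <-> g n = 0.
Proof.
move=> gE gh hm n; split=> [/asboolP nH|gn].
  apply: (completion_separated noethR) => -[|k]; first exact: adic0.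
  by apply: lin_adic; exact: nH.
have [|p pE] := @mk_linear R N N (fun y => y - h (g y)).
  by move=> a x y; rewrite !linearP scalerDr addrACA.
have gp y : g (p y) = 0 by rewrite pE linearB gh subrr.
have pk x : g x = 0 -> p x = x by rewrite pE => ->; rewrite linear0 subr0.
have key k : forall x, g x = 0 -> x \in adic m N k.
  elim: k => [|k IH] x gx; first exact: adic0.
  have pS y : y \in ideal_mul m (full N) -> p y \in adic m N k.+1.
    move=> ym; have : p y \in ideal_mul m (adic m N k).
      by apply: lin_ideal_mul ym => z _; exact/IH/gp.
    by apply: ideal_mul_sub => a z; exact: mul_adicS.
  have [y xy] := hull_sum_ideal_mul x.
  rewrite -(pk x gx) -(subrK (i y) x) linearD rpredD //; first exact: pS.
  rewrite -(pk (p (i y)) (gp _)); apply: pS.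
  by rewrite pE gE.
by apply/asboolP => k _; exact: key.
Qed.

End Hull.

(** * Associated primes of the completion and annihilators of submodules *)

Section AssociatedPrimes.
Context {R : comNzRingType} {m : {pred R}} {M : lmodType R}.
Local Notation L := (completion m M).
Hypotheses (noethR : noetherian R) (localR : local_ring m).
Hypotheses (sepM : separated m M) (flatL : flat L).

Lemma separated_adic x : (forall n, x \in adic m M n) -> x = 0.
Proof. by move=> H; apply: sepM; apply/asboolP. Qed.

Lemma to_completion_inj x : to_completion x = 0 :> L -> x = 0.
Proof.
move=> x0; apply: separated_adic => n.
by have := coord_to_completion (m := m) n x; rewrite x0 linear0 => /esym/quot_pi0.
Qed.

Lemma prime_proper (p : {pred R}) : prime_ideal p -> 1 \notin p.
Proof. by move=> [[]]. Qed.

(** Let K be the annihilator of p in R. By flatness U lies in K V. If every generator of K were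
    killed by some element outside p, the product of these elements would be outside p and kill U, a
    contradiction; so a generator has annihilator p. *)
Lemma prime_annihilator_ring (V : lmodType R) (p : {pred R}) (U : V -> Prop) :
  flat V -> prime_ideal p ->
  (forall r, r \in p <-> forall u, U u -> r *: u = 0) ->
  exists a, forall r, r \in p <-> r * a = 0.
Proof.
move=> flatV [[p0 p1 pD] pP] pU.
have [||I IP] := @mk_sub R R^o (fun x => x \in p).
- exact: p0.
- by move=> b u v up vp; exact: pD.
have [s _ sE] := ideal_gens noethR I.
have [||K KP] := @mk_sub R R^o (fun a => forall q, q \in s -> q * a = 0 :> R).
- by move=> q _; rewrite mulr0.
- by move=> b u v u0 v0 q qs; rewrite mulrDr [q * _]mulrCA u0 // v0 // mulr0 addr0.
have [t _ tE] := ideal_gens noethR K.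
have UK u : U u -> u \in ideal_mul K (full V).
  move=> Uu; have <- : lin_ext (fun _ : unit => u) << tt >> = u by rewrite lin_extU.
  apply: (flat_functional (gs := [seq q *: << tt >> | q <- s])) => //.
    move=> _ /mapP[q qs ->]; rewrite linearZ /= lin_extU.
    apply: (pU q).1 => //; apply/IP; rewrite sE.
    exact: (@mem_span R R^o (fun x => x \in s)).
  move=> k kP; rewrite lin_extU; apply/KP => q qs.
  by have := kP (q *: << tt >>) (map_f _ qs); rewrite linearZ /= lin_extU.
have [[a ta ap]|na] := pselect (exists2 a, a \in t & forall r, r * a = 0 -> r \in p).
  exists a => r; split; last exact: ap.
  move=> /IP; rewrite sE.
  have [||X XP] := @mk_sub R R^o (fun r => r * a = 0 :> R).
  - by rewrite mul0r.
  - by move=> b u v ua va; rewrite mulrDl -mulrA ua va mulr0 addr0.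
  move=> rs; apply/XP; apply: span_min rs => q qs; apply/XP.
  have /KP : a \in K by rewrite tE; exact: (@mem_span R R^o (fun x => x \in t)).
  exact.
have : exists2 r, r \notin p & forall a, a \in t -> r * a = 0.
  elim: t na {tE} => [_|a t IH na]; first by exists 1.
  have [|r rp rt] := IH; first by move=> [b bt H]; apply: na; exists b; rewrite // inE bt orbT.
  have [r' r'a r'p] : exists2 r, r * a = 0 & r \notin p.
    apply: contrapT => H; apply: na; exists a; rewrite ?mem_head // => r' r'a.
    by apply: contrapT => /negP r'p; apply: H; exists r'.
  exists (r' * r) => [|b].
    by apply/negP => /pP/orP[]; apply/negP.
  rewrite inE => /orP[/eqP ->|/rt rb]; first by rewrite mulrAC r'a mul0r.
  by rewrite -mulrA rb mulr0.
move=> [r /negP rp rt]; case: rp; apply/pU => u /UK.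
move: u; apply: span_ind; first by rewrite scaler0.
  by move=> b u v u0 v0; rewrite scalerDr scalerA mulrC -scalerA u0 v0 scaler0 addr0.
move=> _ [a + [v _ ->]]; rewrite tE scalerA => ats.
suff -> : r * a = 0 by rewrite scale0r.
move: a ats; apply: (@span_ind R R^o _ (fun a : R => r * a = 0)) => //.
  by rewrite mulr0.
by move=> b u w u0 w0; rewrite mulrDr mulrCA u0 w0 mulr0 addr0.
Qed.

(** Separatedness makes the basis of M/mM nonempty, and a basis vector has zero annihilator because
    F embeds in L. *)
Lemma regular_element : (exists x : M, x != 0) -> exists x : M, forall r, r *: x = 0 -> r = 0.
Proof.
move=> [x1 x1n0]; have [J [v [v_free v_gen]]] := @basis_mod_maximal R m M noethR localR.
have [j _] : exists j : J, True.
  apply: contrapT => nJ; move/negP: x1n0; apply; apply/eqP; apply: separated_adic => n.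
  have [s us sE] := maximal_ideal_gens noethR localR.
  elim: n x1 => [|n IH] x1; first exact: adic0.
  have [c] := v_gen x1; have -> : c = 0 by apply/malgP => j; case: nJ; exists j.
  rewrite linear0 subr0 => /(ideal_mul_gens _ us sE)[y _ ->].
  rewrite big_seq rpred_sum // => q qs; apply: mul_adicS => //.
  by rewrite sE; exact: (@mem_span R R^o (fun x => x \in s)).
exists (v j) => r rv.
have := @basis_injective R m M noethR localR flatL J v v_free (r *: << j >>) 0.
rewrite !linear0 linearZ /= lin_extU rv linear0 => /(_ erefl)/malgP/(_ j).
by rewrite mcoeffZ mcoeffUU mulr1 mcoeff0.
Qed.

Lemma ann_singleton (V : lmodType R) (x : V) r : r \in ann (pred1 x) <-> r *: x = 0.
Proof.
split=> [/asboolP H|rx]; first by apply: H; rewrite inE.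
by apply/asboolP => u; rewrite inE => /eqP ->.
Qed.

(** With x of zero annihilator, a x has the same annihilator as a; it serves as an element of L and
    as the generator of a submodule of M. *)
Lemma prime_annihilators_realized (p : {pred R}) a : (exists x : M, x != 0) ->
  prime_ideal p -> (forall r, r \in p <-> r * a = 0) -> Ass L p /\ Koatt M p.
Proof.
move=> /regular_element[x xr] pP pa.
have pax r : r \in p <-> r *: (a *: x) = 0.
  by rewrite scalerA; split=> [/pa ->|/xr/pa //]; rewrite scale0r.
split; split => //.
  exists (to_completion (a *: x)) => r; apply/idP/idP => [/pax rp|].
    by apply/ann_singleton; rewrite -linearZ rp linear0.
  by move=> /ann_singleton; rewrite -linearZ => /to_completion_inj/pax.
exists (span (fun y => y = a *: x)) => r; apply/idP/idP => [/pax rp|/asboolP H].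
  apply/asboolP; apply: span_ind; first by rewrite scaler0.
    by move=> b u v u0 v0; rewrite scalerDr scalerA mulrC -scalerA u0 v0 scaler0 addr0.
  by move=> _ ->.
by apply/pax; apply: H; exact: mem_span.
Qed.

Lemma Ass_completion_Koatt (p : {pred R}) : Ass L p <-> Koatt M p.
Proof.
split=> [[pP [z pz]]|[pP [U pU]]].
  have [a pa] : exists a, forall r, r \in p <-> r * a = 0.
    apply: (@prime_annihilator_ring L p (fun u => u = z)) => // r.
    rewrite pz; split=> [/ann_singleton rz u -> //|H].
    by apply/ann_singleton; exact: H.
  apply: (prime_annihilators_realized _ pP pa).2.
  (* If M were zero, then L would be zero, and 1 would annihilate z and lie in p. *)
  apply: contrapT => nM; move/negP: (prime_proper pP); apply.
  rewrite pz; apply/ann_singleton; rewrite scale1r; apply: coord_inj => n.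
  have [x xE] := quot_pi_surj (adic_coord n z).
  rewrite linear0 xE; apply/quot_pi0.
  suff -> : x = 0 by exact: rpred0.
  by apply: contrapT => /eqP xn0; apply: nM; exists x.
have pU' r : r \in p <-> forall u, u \in U -> r *: u = 0.
  by rewrite pU; split => [/asboolP|H] //; apply/asboolP.
have [a pa] : exists a, forall r, r \in p <-> r * a = 0.
  apply: (@prime_annihilator_ring L p (fun u => exists2 y, y \in U & u = to_completion y)) => // r.
  split=> [/pU' H _ [y yU ->]|H]; first by rewrite -linearZ H // linear0.
  apply/pU' => y yU; apply: to_completion_inj.
  by rewrite linearZ; apply: H; exists y.
apply: (prime_annihilators_realized _ pP pa).1.
apply: contrapT => nM; move/negP: (prime_proper pP); apply.
apply/pU' => u uU; rewrite scale1r.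
by apply: contrapT => /eqP un0; apply: nM; exists u.
Qed.

End AssociatedPrimes.

Theorem mainTheorem2 (R : comNzRingType) (m : {pred R})
    (noethR : noetherian R) (localR : local_ring m)
    (M : lmodType R) (sepM : separated m M) (flatM : flat (completion m M))
    (N : lmodType R) (i : {linear M -> N}) (hullN : pure_injective_hull i) :
  [/\ radical_full m (quotmod (image_sub i (full M))) /\
        direct_summand (H m N),
      isomorphic (completion m M) (quotmod (H m N))
    & forall p : {pred R}, Ass (completion m M) p <-> Koatt M p].
Proof.
have [g [h [gE gh hm]]] := hull_splitting noethR localR flatM hullN.
have HP := hull_H noethR localR flatM hullN gE gh hm.
split.
- split; first exact: hull_quotient_radical_full.
  (* Since g h = 1, the image of h is a complement of ker g = H(N). *)
  exists (image_sub h (full _)); split=> [x /HP gx /image_subP[z _ xz]|x].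
    by move: gx; rewrite xz gh => ->; rewrite linear0.
  rewrite -(subrK (h (g x)) x); apply: mem_sum_sub; last exact: mem_image_sub.
  by apply/HP; rewrite linearB gh subrr.
- have [|f fE] := @quot_lift R N (completion m M) (H m N) g; first by move=> x /HP.
  exists (quot_pi (H m N) \o h : {linear completion m M -> quotmod (H m N)}).
  exists f => [z|q] /=; first by rewrite fE gh.
  have [x ->] := quot_pi_surj q; rewrite fE; apply/quot_piP/HP.
  by rewrite linearB gh subrr.
- exact: Ass_completion_Koatt.
Qed.
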